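(* Let $M$ be a finitely generated, left cancellative monoid of bounded indegree which is strongly hyperbolic. Then the $\mathcal{J}$-order of $M$ is in $\mathcal{NP}$. If, moreover, $M$ is cancellative, then the $\mathcal{D}$-relation of $M$ is in $\mathcal{NP}$.
   Context: Directed graphs may have loops and multiple edges; $d(u,v)$ is the length of a shortest directed path from $u$ to $v$ ($\infty$ if none). Out-ball $\overrightarrow{\mathcal{B}}_r(x)=\{y : d(x,y)\le r\}$, in-ball $\overleftarrow{\mathcal{B}}_r(x)=\{y : d(y,x)\le r\}$, extended to sets by union. A path $[x_0,\dots,x_n]$ is a geodesic if $n=d(x_0,x_n)$. A directed geodesic triangle is an ordered triple $(p,q,r)$ of geodesics with the end of $p$ equal to the start of $q$ and $p\circ q$ having the same start and end as $r$; it is $\delta$-thin if every vertex of $r$ lies in $\overrightarrow{\mathcal{B}}_\delta(p)\cup\overleftarrow{\mathcal{B}}_\delta(q)$, every vertex of $p$ lies in $\overrightarrow{\mathcal{B}}_\delta(r)\cup\overleftarrow{\mathcal{B}}_\delta(q)$, and every vertex of $q$ lies in $\overrightarrow{\mathcal{B}}_\delta(p)\cup\overleftarrow{\mathcal{B}}_\delta(r)$. A directed graph is strongly $\delta$-hyperbolic if all its directed geodesic triangles are $\delta$-thin. For a monoid $M$ generated by a finite set $A$, the right Cayley graph has vertex set $M$ and an edge $m\to n$ for each $a\in A$ with $ma=n$. $M$ is strongly hyperbolic if its right Cayley graph w.r.t. some finite generating set is strongly $\delta$-hyperbolic for some $\delta\ge0$. $M$ has bounded indegree if for a finite generating set $A$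 there is $\alpha$ such that no $a\in A$ and $\alpha+1$ distinct $x_0,\dots,x_\alpha\in M$ satisfy $x_0a=\dots=x_\alpha a$. Green's relations: $x\le_{\mathcal{J}} y$ iff $MxM\subseteq MyM$; $x\,\mathcal{L}\,y$ iff $Mx=My$; $x\,\mathcal{R}\,y$ iff $xM=yM$; $x\,\mathcal{D}\,y$ iff there is $c$ with $x\,\mathcal{L}\,c$ and $c\,\mathcal{R}\,y$. A relation being ''in $\mathcal{NP}$'' means deciding, given two words over a finite generating set, whether the represented elements are related, is in $\mathcal{NP}$. *)

(* Defs.v *)
From Stdlib Require List.
From mathcomp Require Import all_boot.
Set Implicit Arguments. Unset Strict Implicit. Unset Printing Implicit Defensive.

Section MonoidDefs.
Variables (M : Type) (mul : M -> M -> M) (one : M).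

Definition is_monoid : Prop :=
  [/\ forall x y z, mul x (mul y z) = mul (mul x y) z,
      forall x, mul one x = x & forall x, mul x one = x].

Definition eval_word (A : Type) (gen : A -> M) (w : seq A) : M :=
  foldr (fun a m => mul (gen a) m) one w.

Definition generates (A : Type) (gen : A -> M) : Prop :=
  forall m : M, exists w : seq A, m = eval_word gen w.

Definition left_cancellative : Prop :=
  forall a b c, mul a b = mul a c -> b = c.
Definition right_cancellative : Prop :=
  forall a b c, mul b a = mul c a -> b = c.
Definition cancellative : Prop := left_cancellative /\ right_cancellative.

Definition bounded_indegree (A : Type) (gen : A -> M) : Prop :=
  exists alpha : nat, forall (a : A) (x : 'I_alpha.+1 -> M),
    injective x -> ~ (forall i j, mul (x i) (gen a) = mul (x j) (gen a)).

Definition J_le (x y : M) : Prop :=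
  forall z, (exists p q, z = mul (mul p x) q) -> exists p q, z = mul (mul p y) q.
Definition L_rel (x y : M) : Prop :=
  forall z, (exists p, z = mul p x) <-> (exists p, z = mul p y).
Definition R_rel (x y : M) : Prop :=
  forall z, (exists p, z = mul x p) <-> (exists p, z = mul y p).
Definition D_rel (x y : M) : Prop := exists c, L_rel x c /\ R_rel c y.

Variables (B : Type) (genB : B -> M).

Definition cay_edge (m n : M) : Prop := exists b : B, mul m (genB b) = n.

Fixpoint cay_path (x : M) (s : seq M) : Prop :=
  match s with
  | [::] => True
  | y :: s' => cay_edge x y /\ cay_path y s'
  end.

Definition dist_le (u v : M) (k : nat) : Prop :=
  exists s, cay_path u s /\ last u s = v /\ size s <= k.

Definition geodesic (x : M) (s : seq M) : Prop :=
  cay_path x s /\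
  forall t, cay_path x t -> last x t = last x s -> size s <= size t.

Definition in_out_ball (d : nat) (x : M) (s : seq M) (y : M) : Prop :=
  exists z, List.In z (x :: s) /\ dist_le z y d.
Definition in_in_ball (d : nat) (x : M) (s : seq M) (y : M) : Prop :=
  exists z, List.In z (x :: s) /\ dist_le y z d.

Definition geodesic_triangle px ps qx qs rx rs : Prop :=
  [/\ geodesic px ps, geodesic qx qs & geodesic rx rs] /\
  [/\ last px ps = qx, rx = px & last rx rs = last qx qs].

Definition thin_triangle (d : nat) px ps qx qs rx rs : Prop :=
  [/\ forall v, List.In v (rx :: rs) ->
        in_out_ball d px ps v \/ in_in_ball d qx qs v,
      forall v, List.In v (px :: ps) ->
        in_out_ball d rx rs v \/ in_in_ball d qx qs v &
      forall v, List.In v (qx :: qs) ->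
        in_out_ball d px ps v \/ in_in_ball d rx rs v].

Definition strongly_hyperbolic_graph (d : nat) : Prop :=
  forall px ps qx qs rx rs, geodesic_triangle px ps qx qs rx rs ->
    thin_triangle d px ps qx qs rx rs.

End MonoidDefs.

Definition strongly_hyperbolic_monoid (M : Type) (mul : M -> M -> M) (one : M)
  : Prop :=
  exists (B : finType) (genB : B -> M),
    generates mul one genB /\ exists d : nat, strongly_hyperbolic_graph mul genB d.

Inductive tm_move := MoveL | MoveR | Stay.

Section NTM.
Variables (Q G : Type) (blank : G)
          (delta : Q -> G -> Q -> G -> tm_move -> bool).

(* configuration: state, tape left of head (reversed), scanned symbol,
   tape right of head *)
Definition config := (Q * seq G * G * seq G)%type.

Definition ntm_step (c c' : config) : Prop :=
  let: (q, l, x, r) := c in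
  exists q' y mv, delta q x q' y mv /\
    c' = match mv with
         | Stay => (q', l, y, r)
         | MoveL => match l with
                    | [::] => (q', [::], blank, y :: r)
                    | z :: l' => (q', l', z, y :: r)
                    end
         | MoveR => match r with
                    | [::] => (q', y :: l, blank, [::])
                    | z :: r' => (q', y :: l, z, r')
                    end
         end.

Fixpoint ntm_reach (k : nat) (c c' : config) : Prop :=
  match k with
  | 0 => c = c'
  | k'.+1 => exists c'', ntm_step c c'' /\ ntm_reach k' c'' c'
  end.

Definition ntm_init (q0 : Q) (tape : seq G) : config :=
  match tape with
  | [::] => (q0, [::], blank, [::])
  | x :: r => (q0, [::], x, r)
  end.

Definition ntm_accepts_within (q0 qacc : Q) (tape : seq G) (n : nat) : Prop :=
  exists k c, k <= n /\ ntm_reach k (ntm_init q0 tape) c /\ c.1.1.1 = qacc.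
End NTM.

Definition in_NP (Sigma : finType) (Lang : seq Sigma -> Prop) : Prop :=
  exists (Q G : finType) (blank : G) (inp : Sigma -> G) (q0 qacc : Q)
         (delta : Q -> G -> Q -> G -> tm_move -> bool) (c e : nat),
    forall w : seq Sigma,
      Lang w <-> ntm_accepts_within blank delta q0 qacc (map inp w)
                                    (c * (size w) ^ e + c).

(* The decision problem of a binary relation on M, given two words over the
   generating set A: input  u # v  encoded over the alphabet option A. *)
Definition encode_pair (A : Type) (u v : seq A) : seq (option A) :=
  map Some u ++ None :: map Some v.

Definition word_problem_lang (M : Type) (mul : M -> M -> M) (one : M)
  (A : finType) (gen : A -> M) (Rel : M -> M -> Prop) : seq (option A) -> Prop :=
  fun s => exists u v : seq A, s = encode_pair u v /\
             Rel (eval_word mul one gen u) (eval_word mul one gen v).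

Definition relation_in_NP (M : Type) (mul : M -> M -> M) (one : M)
  (A : finType) (gen : A -> M) (Rel : M -> M -> Prop) : Prop :=
  in_NP (word_problem_lang mul one gen Rel).

(* Main.v *)
Require Import Defs.
From HB Require Import structures.
From mathcomp Require Import all_boot boolp zify.

(** Both relations have the form "u = p v q with p and q in U", where U is a
submonoid closed under factors: all of M for the J-order, the group of units for
the D-relation of a cancellative monoid.

Thin triangles and bounded indegree show that if x has a geodesic p, then every
geodesic r of x c, for c of bounded length, follows p with a bounded lag: its
j-th vertex is reached by a bounded path from the (j - C)-th vertex of p. By left
cancellation r is then obtained from p c by a sweep of boundedly many kinds of
local moves, so any word is rewritten to a geodesic in polynomially many steps.

If u = p v q with p as short as possible, then each vertex of p far from u is
either close to one of the first |v| + O(1) vertices of a geodesic for v q, and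
there are few of those because in-balls are bounded, or it is close to the part of
the path labelled q, and then two vertices with the same connecting path would
allow p to be shortened. So |p|, and then |q|, are linear in |u| + |v|.

A nondeterministic machine guesses p and q and rewrites u and p v q to a common
geodesic. It is described by a length-preserving rewriting system acting on pairs
of adjacent tape cells, whose letters are words of bounded length. *)

Set Implicit Arguments. Unset Strict Implicit. Unset Printing Implicit Defensive.

(** * Rewriting systems and Turing machines *)

Definition poly_bounded (f : nat -> nat) : Prop :=
  exists c e, forall n, f n <= c * n ^ e + c.

Lemma poly_bounded_const k : poly_bounded (fun _ => k).
Proof. by exists k, 0 => n; rewrite leq_addl. Qed.

Lemma poly_bounded_id : poly_bounded id.
Proof. by exists 1, 1 => n; rewrite mul1n expn1 leq_addr. Qed.

(** The [+ 1] is there for [n = 0] and [e = 0], where [0 ^ 0 = 1]. *)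
Lemma expn_leD1 n e e' : e <= e' -> n ^ e <= n ^ e' + 1.
Proof.
case: n => [|n] le_e; last by rewrite (leq_trans (leq_pexp2l _ le_e)) // leq_addr.
by case: e {le_e} => [|e]; rewrite ?expn0 ?leq_addl // exp0n.
Qed.

Lemma poly_boundedD f g :
  poly_bounded f -> poly_bounded g -> poly_bounded (fun n => f n + g n).
Proof.
move=> [c [e Hf]] [d [e' Hg]]; exists (2 * (c + d)), (e + e') => n.
have := expn_leD1 n (leq_addr e' e); have := expn_leD1 n (leq_addl e e').
have := Hf n; have := Hg n.
set x := n ^ e; set y := n ^ e'; set z := n ^ (e + e'); nia.
Qed.

Lemma poly_boundedM f g :
  poly_bounded f -> poly_bounded g -> poly_bounded (fun n => f n * g n).
Proof.
move=> [c [e Hf]] [d [e' Hg]]; exists (4 * (c * d)), (e + e') => n.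
apply: leq_trans (leq_mul (Hf n) (Hg n)) _.
have := expn_leD1 n (leq_addr e' e); have := expn_leD1 n (leq_addl e e').
rewrite expnD; set x := n ^ e; set y := n ^ e' => H1 H2.
rewrite mulnDl !mulnDr; set k := c * d.
have -> : c * x * (d * y) = k * (x * y) by rewrite mulnACA.
have -> : c * x * d = k * x by rewrite mulnAC.
have -> : c * (d * y) = k * y by rewrite mulnA.
have := leq_mul (leqnn k) H1; have := leq_mul (leqnn k) H2.
rewrite !mulnDr muln1 -/k; lia.
Qed.

(** * Counted derivations and two-letter rewriting *)

Section Steps.
Variables (T : Type) (R : T -> T -> Prop).

(* [steps n x y] : at most [n] steps lead from [x] to [y]. *)
Inductive steps : nat -> T -> T -> Prop :=
| steps_refl n x : steps n x x
| steps_cons n x y z : R x y -> steps n y z -> steps n.+1 x z.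

Lemma steps_le m n x y : m <= n -> steps m x y -> steps n x y.
Proof.
move=> le_mn H; elim: H n le_mn => [k v|k v1 v2 v3 S12 _ IH] [|n] // le_kn.
- exact: steps_refl.
- exact: steps_refl.
- exact: steps_cons S12 (IH _ le_kn).
Qed.

Lemma steps_trans m n x y z : steps m x y -> steps n y z -> steps (m + n) x z.
Proof.
elim=> [k v|k v1 v2 v3 S12 _ IH] H.
  by apply: steps_le H; rewrite leq_addl.
by rewrite addSn; apply: steps_cons S12 (IH H).
Qed.

Lemma steps1 x y : R x y -> steps 1 x y.
Proof. by move=> H; apply: steps_cons H (steps_refl _ _). Qed.

End Steps.

(** The invariant [I] carries side conditions, such as equal lengths of two tracks, that a single
    step cannot supply. *)
Lemma steps_expand (T T' : Type) (R : T -> T -> Prop) (R' : T' -> T' -> Prop)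
    (I : T -> Prop) (f : T -> T') k n x y :
  (forall x y, I x -> R x y -> I y /\ steps R' k (f x) (f y)) ->
  I x -> steps R n x y -> steps R' (n * k) (f x) (f y).
Proof.
move=> H Ix Rxy; elim: Rxy Ix => {n x y} [n x|n x y z Rxy _ IH] Ix.
  exact: steps_refl.
have [Iy Sxy] := H _ _ Ix Rxy.
by rewrite mulSn; apply: steps_trans Sxy (IH Iy).
Qed.

Lemma steps_homo (T T' : Type) (R : T -> T -> Prop) (R' : T' -> T' -> Prop)
    (f : T -> T') n x y :
  (forall x y, R x y -> R' (f x) (f y)) -> steps R n x y -> steps R' n (f x) (f y).
Proof.
move=> H /(@steps_expand _ _ R R' (fun=> True) f 1); rewrite muln1; apply=> //.
by move=> x1 y1 _ Rxy; split=> //; apply/steps1/H.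
Qed.

Section Rewriting.
Variables (G : Type) (rule : G -> G -> G -> G -> Prop).

Inductive rstep : seq G -> seq G -> Prop :=
  RStep P S x y x' y' : rule x y x' y' ->
    rstep (P ++ x :: y :: S) (P ++ x' :: y' :: S).

Definition rewrites := steps rstep.

Lemma rstep_ctx P S w w' : rstep w w' -> rstep (P ++ w ++ S) (P ++ w' ++ S).
Proof.
case=> P1 S1 x y x' y' H.
have E a b : P ++ (P1 ++ a :: b :: S1) ++ S = (P ++ P1) ++ a :: b :: (S1 ++ S).
  by rewrite -!catA.
by rewrite !E; apply: RStep.
Qed.

Lemma rewrites_ctx P S n w w' :
  rewrites n w w' -> rewrites n (P ++ w ++ S) (P ++ w' ++ S).
Proof. by apply: (steps_homo (f := fun v => P ++ v ++ S)) => x y; apply: rstep_ctx. Qed.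

Lemma rewrites_ctxl P n w w' : rewrites n w w' -> rewrites n (P ++ w) (P ++ w').
Proof. by move/(rewrites_ctx P [::]); rewrite !cats0. Qed.

Lemma rewrites_ctxr S n w w' : rewrites n w w' -> rewrites n (w ++ S) (w' ++ S).
Proof. exact: (rewrites_ctx [::] S). Qed.

Lemma rewrites_rule P S x y x' y' : rule x y x' y' ->
  rewrites 1 (P ++ x :: y :: S) (P ++ x' :: y' :: S).
Proof. by move=> H; apply: steps1; apply: RStep. Qed.

Lemma rstep_size w w' : rstep w w' -> size w' = size w.
Proof. by case=> P S x y x' y' _; rewrite !size_cat. Qed.

Lemma rewrites_size n w w' : rewrites n w w' -> size w' = size w.
Proof. by elim=> // k v1 v2 v3 /rstep_size <-. Qed.

End Rewriting.

(** * A nondeterministic machine simulating a rewriting system *)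

Section RewritingMachine.
Variables (G : finType) (blank accept : G).
Variable rule : G -> G -> G -> G -> Prop.

(* [inl false] scans the tape, [inl true] accepts, and [inr (y, y')] completes
   a rule whose first symbol has just been rewritten: it replaces [y] by [y']. *)
Definition rw_state := (bool + G * G)%type.

Definition rw_delta (q : rw_state) (x : G) (q' : rw_state) (x' : G)
    (mv : tm_move) : bool :=
  match q, q', mv with
  | inl false, inl false, _ => x' == x
  | inl false, inl true, Stay => (x == accept) && (x' == x)
  | inl false, inr (y, y'), MoveR => `[< rule x y x' y' >]
  | inr (y, y'), inl false, Stay => (x == y) && (x' == y')
  | _, _, _ => false
  end.

Notation scan := (inl false : rw_state).
Notation step := (ntm_step blank rw_delta).
Notation reach := (ntm_reach blank rw_delta).

Definition tape_of (l : seq G) (x : G) (r : seq G) := rev l ++ x :: r.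

Definition padded m m' w := nseq m blank ++ w ++ nseq m' blank.

(** The padding is left open because the head may run off either end at any time, each time adding a
    blank to the tape; a derivation survives extra blanks. *)
Definition derivable w v := exists m m' n, rewrites rule n (padded m m' w) v.

Lemma derivable_blankl w v : derivable w v -> derivable w (blank :: v).
Proof.
move=> [m [m' [n H]]]; exists m.+1, m', n.
exact: (rewrites_ctxl [:: blank] H).
Qed.

Lemma derivable_blankr w v : derivable w v -> derivable w (rcons v blank).
Proof.
move=> [m [m' [n H]]]; exists m, m'.+1, n.
rewrite -cats1; have := rewrites_ctxr [:: blank] H.
suff -> : padded m m'.+1 w = padded m m' w ++ [:: blank] by [].
by rewrite /padded -!catA -addn1 nseqD.
Qed.

Lemma derivable_step w v v' : derivable w v -> rstep rule v v' -> derivable w v'.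
Proof.
move=> [m [m' [n H]]] H'; exists m, m', (n + 1).
exact: steps_trans H (steps1 H').
Qed.

(** Between the two halves of a rule the invariant speaks of the tape with the first symbol
    restored. The guessed [y] is compared with the scanned symbol only when the rule is completed,
    so a wrong guess merely blocks. *)
Definition config_inv w (c : config rw_state G) : Prop :=
  let: (q, l, x, r) := c in
  match q with
  | inl false => derivable w (tape_of l x r)
  | inl true => exists v, derivable w v /\ accept \in v
  | inr (y, y') => exists x1 x1' l1, [/\ l = x1' :: l1, rule x1 y x1' y' &
                     derivable w (tape_of l1 x1 (x :: r))]
  end.

Lemma config_inv_step w c c' : config_inv w c -> step c c' -> config_inv w c'.
Proof.
move: c => [[[q l] x] r] Hinv [q' [y [mv [D ->]]]].
case: q q' D Hinv => [[]|[z z']] [[]|[t t']] //.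
- case: mv => //= /andP[/eqP-> _] H; exists (tape_of l accept r).
  by rewrite /tape_of mem_cat inE eqxx orbT.
- case: mv => /= /eqP-> H //.
  + case: l H => [|a l] /=; first exact: derivable_blankl.
    by rewrite /tape_of rev_cons cat_rcons.
  + case: r H => [|a r] /=; rewrite /tape_of rev_cons ?cat_rcons //.
    by move/derivable_blankr; rewrite -cats1 -catA.
- case: mv => //= /asboolP R H; case: r H => [|a r] H; exists x, y, l; split=> //.
  by move/derivable_blankr: H; rewrite -cats1 /tape_of -catA.
- case: mv => //= /andP[/eqP-> /eqP->] [x1 [x1' [l1 [-> R H]]]].
  apply: derivable_step H _; rewrite /tape_of rev_cons cat_rcons; exact: RStep.
Qed.

Lemma rw_machine_sound w n :
  ntm_accepts_within blank rw_delta scan (inl true) w n ->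
  exists v, derivable w v /\ accept \in v.
Proof.
move=> [k [c [_ [R E]]]].
have I0 : config_inv w (ntm_init blank scan w).
  case: w {R} => [|a w] /=; first by exists 1, 0, 0; apply: steps_refl.
  by exists 0, 0, 0; rewrite /padded /= cats0; apply: steps_refl.
suff : config_inv w c by move: E; case: c {R} => [[[q l] x] r] /= ->.
elim: k (ntm_init _ _ _) I0 R => [|k IH] c0 I0 /=; first by move=> <-.
by move=> [c1 [S01 R]]; apply: IH R; apply: config_inv_step S01.
Qed.

Definition reach_le n c c' := exists2 k, k <= n & reach k c c'.

Lemma reach_cat m n c1 c2 c3 : reach m c1 c2 -> reach n c2 c3 -> reach (m + n) c1 c3.
Proof.
elim: m c1 => [|m IH] c1 /=; first by move=> ->.
by move=> [c [S1 R1]] R2; exists c; split=> //; apply: IH.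
Qed.

Lemma reach_le_trans m n c1 c2 c3 :
  reach_le m c1 c2 -> reach_le n c2 c3 -> reach_le (m + n) c1 c3.
Proof.
move=> [k km R1] [j jn R2]; exists (k + j); first exact: leq_add.
exact: reach_cat R1 R2.
Qed.

Lemma reach_le_step n c1 c2 c3 : step c1 c2 -> reach_le n c2 c3 -> reach_le n.+1 c1 c3.
Proof. by move=> S12 [k kn R]; exists k.+1 => //=; exists c2. Qed.

Lemma reach_le_refl n c : reach_le n c c. Proof. by exists 0. Qed.

Lemma reach_le_mono m n c c' : m <= n -> reach_le m c c' -> reach_le n c c'.
Proof. by move=> mn [k km R]; exists k => //; apply: leq_trans mn. Qed.

Lemma scan_left n l1 l x r :
  reach_le (size l1 + n) (scan, rev l1 ++ l, x, r)
    (let v := l1 ++ x :: r in (scan, l, head x v, behead v)).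
Proof.
elim/last_ind: l1 x r => [|l1 a IH] x r /=; first exact: reach_le_refl.
rewrite size_rcons addSn rev_rcons /=.
apply: (@reach_le_step _ _ (scan, rev l1 ++ l, a, x :: r)).
  by exists scan, x, MoveL; rewrite /= eqxx.
have := IH a (x :: r); rewrite cat_rcons /=.
by case: (l1).
Qed.

Lemma scan_right l x r1 y r :
  reach_le (size r1).+1 (scan, l, x, r1 ++ y :: r) (scan, rev (x :: r1) ++ l, y, r).
Proof.
elim: r1 l x => [|a r1 IH] l x /=.
  apply: (reach_le_step _ (reach_le_refl _ _)).
  by exists scan, x, MoveR; rewrite /= eqxx.
apply: (@reach_le_step _ _ (scan, x :: l, a, r1 ++ y :: r)).
  by exists scan, x, MoveR; rewrite /= eqxx.
suff -> : rev [:: x, a & r1] ++ l = rev (a :: r1) ++ x :: l by [].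
by rewrite !rev_cons !cat_rcons.
Qed.

(** The target cell lies either weakly left or strictly right of the head, and one sweep in that
    direction reaches it. *)
Lemma scan_to l x r P y s : tape_of l x r = P ++ y :: s ->
  reach_le (size (tape_of l x r)) (scan, l, x, r) (scan, rev P, y, s).
Proof.
rewrite /tape_of => E.
have [le_Pl|lt_lP] := leqP (size P) (size l).
- have El : rev l = P ++ drop (size P) (rev l).
    have := congr1 (take (size P)) E.
    rewrite takel_cat ?size_rev // take_size_cat // => E'.
    by rewrite -{1}(cat_take_drop (size P) (rev l)) E'.
  set l1 := drop _ _ in El.
  have -> : l = rev l1 ++ rev P by rewrite -rev_cat -El revK.
  have /= := scan_left (size P).+1 l1 (rev P) x r.
  move: E; rewrite El -catA => /eqP; rewrite eqseq_cat // eqxx => /eqP /= ->.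
  by apply: reach_le_mono; rewrite !(size_cat, size_rev) /=; lia.
- have Er : P = rev l ++ x :: behead (drop (size l) P).
    have := congr1 (take (size P)) E.
    rewrite (take_size_cat _ (erefl (size P))) take_cat size_rev ltnNge (ltnW lt_lP) /=.
    rewrite -(subnSK lt_lP) /= => EP.
    by move: (take _ r) EP => r1 <-; rewrite drop_size_cat ?size_rev.
  set r1 := behead _ in Er.
  move/eqP: E; rewrite Er -catA eqseq_cat // eqxx /= eqseq_cons eqxx /= => /eqP->.
  rewrite rev_cat revK; apply: reach_le_mono (scan_right _ _ _ _ _).
  by rewrite !size_cat /= size_cat /=; lia.
Qed.

Lemma machine_rstep l x r v' :
  rstep rule (tape_of l x r) v' ->
  exists l' x' r', tape_of l' x' r' = v' /\
    reach_le (size v').+2 (scan, l, x, r) (scan, l', x', r').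
Proof.
move=> H; move Ev: (tape_of l x r) H => v H; case: H Ev => P s y z y' z' R E.
exists (y' :: rev P), z', s; split.
  by rewrite /tape_of rev_cons revK cat_rcons.
have := scan_to E; rewrite E => H.
have -> : (size (P ++ [:: y', z' & s])).+2 = size (P ++ [:: y, z & s]) + 2.
  by rewrite addn2 !size_cat.
apply: reach_le_trans H _.
apply: (@reach_le_step _ _ (inr (z, z'), y' :: rev P, z, s)).
  by exists (inr (z, z')), y', MoveR; split=> //=; apply/asboolP.
apply: reach_le_step (reach_le_refl _ _).
by exists scan, z', Stay; rewrite /= !eqxx.
Qed.

Lemma machine_rewrites l x r n v' :
  rewrites rule n (tape_of l x r) v' ->
  exists l' x' r', tape_of l' x' r' = v' /\
    reach_le (n * (size v').+2) (scan, l, x, r) (scan, l', x', r').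
Proof.
move=> H; move Ev: (tape_of l x r) H => v H.
elim: H l x r Ev => {n v v'} [n v|n v1 v2 v3 S12 R23 IH] l x r E.
  by exists l, x, r; split=> //; apply: reach_le_refl.
move: S12; rewrite -E => /machine_rstep [l2 [x2 [r2 [E2 R2]]]].
have [l3 [x3 [r3 [E3 R3]]]] := IH _ _ _ E2.
exists l3, x3, r3; split=> //; rewrite mulSn (rewrites_size R23).
apply: reach_le_trans R2 _; by rewrite -(rewrites_size R23).
Qed.

Lemma scan_right_end l x r :
  reach_le (size r).+1 (scan, l, x, r) (scan, rev (x :: r) ++ l, blank, [::]).
Proof.
elim: r l x => [|a r IH] l x /=.
  apply: (reach_le_step _ (reach_le_refl _ _)).
  by exists scan, x, MoveR; rewrite /= eqxx.
apply: (@reach_le_step _ _ (scan, x :: l, a, r)).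
  by exists scan, x, MoveR; rewrite /= eqxx.
suff -> : rev [:: x, a & r] ++ l = rev (a :: r) ++ x :: l by [].
by rewrite !rev_cons !cat_rcons.
Qed.

Lemma scan_left_blanks m x r :
  reach_le m (scan, [::], x, r)
    (let v := nseq m blank ++ x :: r in (scan, [::], head x v, behead v)).
Proof.
elim: m => [|m IH] /=; first exact: reach_le_refl.
rewrite -addn1; apply: reach_le_trans IH _.
apply: reach_le_step (reach_le_refl _ _) => /=.
exists scan, (head x (nseq m blank ++ x :: r)), MoveL; rewrite /= eqxx.
by split=> //; case: m.
Qed.

(** The head goes left to create [m] blanks, then right past the input to create one. Each rule
    costs at most one walk over the tape plus two steps, and a last walk finds [accept]. *)
Lemma rw_machine_complete m n w v : w != [::] ->
  rewrites rule n (padded m 1 w) v -> accept \in v ->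
  ntm_accepts_within blank rw_delta scan (inl true) w
    ((n.+2 + 2) * (m + size w + 4)).
Proof.
case: w => // a w _ R acc.
have sz := rewrites_size R; rewrite /padded !size_cat size_nseq /= in sz.
have H1 := scan_left_blanks m a w.
set v0 := nseq m blank ++ a :: w in H1.
have Ev0 : head a v0 :: behead v0 = v0 by rewrite /v0; case: (m).
have H2 := scan_right_end [::] (head a v0) (behead v0).
rewrite Ev0 cats0 in H2.
have Et : tape_of (rev v0) blank [::] = padded m 1 (a :: w).
  by rewrite /tape_of revK /padded /v0 -catA.
have [l [x [r [E3 H3]]]] : exists l x r, tape_of l x r = v /\
    reach_le (n * (size v).+2) (scan, rev v0, blank, [::]) (scan, l, x, r).
  by apply: machine_rewrites; rewrite Et.
have [P [s Ev]] : exists P s, v = P ++ accept :: s.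
  by case/splitPr: acc => P s; exists P, s.
have H4 : reach_le (size v) (scan, l, x, r) (scan, rev P, accept, s).
  by rewrite -E3; apply: scan_to; rewrite E3.
have H5 : reach_le 1 (scan, rev P, accept, s) (inl true, rev P, accept, s).
  apply: reach_le_step (reach_le_refl _ _).
  by exists (inl true), accept, Stay; rewrite /= !eqxx.
have [k le_k Rk] := reach_le_trans H1 (reach_le_trans H2 (reach_le_trans H3
  (reach_le_trans H4 H5))).
exists k, (inl true, rev P, accept, s); split=> //.
apply: leq_trans le_k _.
have -> : size (behead v0) = m + size w.
  by rewrite size_behead /v0 size_cat size_nseq /= addnS.
rewrite sz /=.
have -> : (m + (size w + 1).+1).+2 = m + (size w).+1 + 3 by lia.
have arith i b : i + ((i + b).+1 + (n * (i + b.+1 + 3) + (i + (b.+1 + 1) + 1))) <=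
    (n.+2 + 2) * (i + b.+1 + 4).
  by rewrite addn2 !mulSn (addnS _ 3) mulnS; move: (n * _) => t; lia.
exact: arith.
Qed.

End RewritingMachine.

(** Soundness is asked for every amount of padding, because nothing stops the machine from creating
    more blanks than an efficient run needs. *)
Theorem rewriting_in_NP (S G : finType) (blank : G) (inp : S -> G) (accept : G)
    (rule : G -> G -> G -> G -> Prop) (Lang : seq S -> Prop) (f : nat -> nat) :
  poly_bounded f ->
  ~ Lang [::] ->
  (forall w, Lang w -> exists m v, [/\ m <= f (size w),
     rewrites rule (f (size w)) (padded blank m 1 (map inp w)) v & accept \in v]) ->
  (forall w m m' n v, rewrites rule n (padded blank m m' (map inp w)) v ->
     accept \in v -> Lang w) ->
  in_NP Lang.
Proof.
move=> Pf Lnil complete sound.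
have Pg : poly_bounded (fun n => (f n + 4) * (f n + n + 4)).
  apply: poly_boundedM; apply: poly_boundedD; try exact: poly_bounded_const => //.
    exact: Pf.
  by apply: poly_boundedD => //; apply: poly_bounded_id.
have [c [e Hce]] := Pg.
exists (rw_state G), G, blank, inp, (inl false), (inl true).
exists (rw_delta accept rule), c, e => w; split.
- move=> Lw; have [m [v [le_m R acc]]] := complete w Lw.
  have nw : map inp w != [::] by case: (w) Lw.
  have [k [cf [le_k H]]] := rw_machine_complete nw R acc.
  exists k, cf; split=> //; apply: leq_trans le_k _; apply: leq_trans (Hce _).
  by rewrite size_map; apply: leq_mul; lia.
- move/rw_machine_sound => [v [[m [m' [n R]]] acc]].
  exact: sound R acc.
Qed.

(** * Geometry of the Cayley graph *)

(** [R] need not be functional, so the elements related to the first [y] are split off and the rest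
    is treated by induction on [ys]. *)
Lemma pigeonhole (T T' : eqType) (R : T -> T' -> Prop) (s : seq T) (ys : seq T') N :
  uniq s ->
  (forall x, x \in s -> exists2 y, y \in ys & R x y) ->
  (forall y s', uniq s' -> {subset s' <= s} -> (forall x, x \in s' -> R x y) ->
     size s' <= N) ->
  size s <= size ys * N.
Proof.
elim: ys s => [|y ys IH] s Us Hs HN.
  by case: s Us Hs {HN} => // x s _ /(_ x (mem_head _ _)) [].
pose a x := `[< R x y >].
rewrite /= mulSn -(count_predC a s) -!size_filter; apply: leq_add.
  apply: (HN y); rewrite ?filter_uniq // => x; rewrite mem_filter; first by case/andP.
  by case/andP=> /asboolP.
apply: IH; rewrite ?filter_uniq //.
  move=> x; rewrite mem_filter /= => /andP[/asboolPn nR xs].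
  have [z] := Hs x xs; rewrite inE => /predU1P[->//|zys R'].
  by exists z.
move=> z s' Us' sub; apply: HN => // x /sub.
by rewrite mem_filter => /andP[].
Qed.

Lemma finite_bound (T : finType) (P : T -> nat -> Prop) :
  (forall x m n, m <= n -> P x m -> P x n) ->
  (forall x, exists n, P x n) -> exists n, forall x, P x n.
Proof.
move=> mono /choice[f Hf]; exists (\max_x f x) => x.
exact: mono (leq_bigmax x) (Hf x).
Qed.

Section Monoid.
Variables (M : eqType) (mul : M -> M -> M) (one : M).
Hypothesis mon : is_monoid mul one.
Local Notation "x ** y" := (mul x y) (at level 40, left associativity).

Lemma mA x y z : x ** (y ** z) = x ** y ** z. Proof. by case: mon. Qed.
Lemma m1x x : one ** x = x. Proof. by case: mon. Qed.
Lemma mx1 x : x ** one = x. Proof. by case: mon. Qed.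

Lemma eval_cat (A : Type) (gen : A -> M) s t :
  eval_word mul one gen (s ++ t) = eval_word mul one gen s ** eval_word mul one gen t.
Proof. by elim: s => [|a s IH] /=; rewrite ?m1x // IH mA. Qed.

Lemma eval_rcons (A : Type) (gen : A -> M) s a :
  eval_word mul one gen (rcons s a) = eval_word mul one gen s ** gen a.
Proof. by rewrite -cats1 eval_cat /= mx1. Qed.

Section Fibres.

(** Right multiplication by [x] is at most [N]-to-one. *)
Definition fibre_le (x : M) N :=
  forall y s, uniq s -> (forall z, z \in s -> z ** x = y) -> size s <= N.

Lemma fibre_le_mono x m n : m <= n -> fibre_le x m -> fibre_le x n.
Proof. by move=> mn H y s Us Hs; apply: leq_trans mn; apply: H Hs. Qed.

Lemma fibre_le_one : fibre_le one 1.
Proof.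
move=> y [|z1 [|z2 s]] //= /andP[]; rewrite inE => /norP[/eqP ne _] _ H.
case: ne; rewrite -(mx1 z1) -(mx1 z2) !H ?inE ?eqxx ?orbT //.
Qed.

Lemma fibre_le_mul x y m n : fibre_le x m -> fibre_le y n -> fibre_le (x ** y) (n * m).
Proof.
move=> Hx Hy w s Us Hs.
pose ys := undup [seq z ** x | z <- s].
have le_ys : size ys <= n.
  apply: (Hy w); first exact: undup_uniq.
  by move=> z; rewrite mem_undup => /mapP[t ts ->]; rewrite -mA Hs.
apply: (@leq_trans (size ys * m)); last by rewrite leq_mul2r le_ys orbT.
apply: (@pigeonhole _ _ (fun z y => z ** x = y)) => //.
  by move=> z zs; exists (z ** x) => //; rewrite mem_undup map_f.
by move=> z s' Us' _; apply: Hx.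
Qed.

(** Fibre bounds multiply along products, so bounded indegree for one generating set bounds the
    fibres of every element. This transfers the hypothesis to the generators of the hyperbolic
    Cayley graph. *)
Lemma fibre_le_all (A : finType) (gen : A -> M) :
  generates mul one gen -> bounded_indegree mul gen ->
  forall x, exists N, fibre_le x N.
Proof.
move=> Gen [alpha Hal] x; have [w ->] := Gen x.
elim: w => [|a w [N IH]] /=; first by exists 1; apply: fibre_le_one.
exists (N * alpha); apply: fibre_le_mul IH => y s Us Hs.
rewrite leqNgt; apply/negP => lt_s.
have mem (i : 'I_alpha.+1) : nth one s i \in s.
  by rewrite mem_nth // (leq_trans (ltn_ord i)).
apply: (Hal a (fun i : 'I_alpha.+1 => nth one s i)); last first.
  by move=> i j; rewrite !Hs.
move=> i j /eqP; rewrite nth_uniq ?(leq_trans (ltn_ord _)) //.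
by move/eqP/val_inj.
Qed.

End Fibres.

Variables (B : finType) (genB : B -> M).
Local Notation ev := (eval_word mul one genB).

(** Distance expressed through a connecting word, which left translation preserves; [dist_leP]
    identifies it with [dist_le]. *)
Definition near k x y := exists2 t, size t <= k & x ** ev t = y.

Lemma near_refl k x : near k x x. Proof. by exists [::]; rewrite ?mx1. Qed.

Lemma near_trans a b x y z : near a x y -> near b y z -> near (a + b) x z.
Proof.
move=> [s sa <-] [t tb <-]; exists (s ++ t); first by rewrite size_cat leq_add.
by rewrite eval_cat mA.
Qed.

Lemma near_mull k z x y : near k x y -> near k (z ** x) (z ** y).
Proof. by move=> [t tk <-]; exists t; rewrite // mA. Qed.

Lemma take_split (T : Type) (p : seq T) i j : i <= j ->
  take j p = take i p ++ drop i (take j p).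
Proof. by move=> ij; rewrite -{1}(cat_take_drop i (take j p)) take_takel. Qed.

Lemma near_take p i j k : i <= j -> j <= i + k ->
  near k (ev (take i p)) (ev (take j p)).
Proof.
move=> ij le_k; exists (drop i (take j p)).
  by rewrite size_drop size_take; case: ifP; lia.
by rewrite -eval_cat -take_split.
Qed.

Lemma near_end p i k : size p <= i + k -> near k (ev (take i p)) (ev p).
Proof.
move=> le_k; exists (drop i p); first by rewrite size_drop; lia.
by rewrite -eval_cat cat_take_drop.
Qed.

(** By left cancellation such a word labels a geodesic from every vertex, see [geodesic_verts]. *)
Definition gword w := forall w', ev w' = ev w -> size w <= size w'.

Lemma gword_exists : generates mul one genB -> forall m, exists2 w, gword w & ev w = m.
Proof.
move=> Gen m.
have ex : exists n, `[< exists2 w, size w = n & ev w = m >].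
  by have [w ->] := Gen m; exists (size w); apply/asboolP; exists w.
case: (ex_minnP ex) => n /asboolP[w sz E] min; exists w => // w' E'.
by rewrite sz; apply: min; apply/asboolP; exists w' => //; rewrite E'.
Qed.

Lemma gword_take i w : gword w -> gword (take i w).
Proof.
move=> gw w' E; have := gw (w' ++ drop i w).
rewrite eval_cat E -eval_cat cat_take_drop => /(_ erefl).
by rewrite -{1}(cat_take_drop i w) !size_cat leq_add2r.
Qed.

Lemma gword_take_inj w i j : gword w -> i <= size w -> j <= size w ->
  ev (take i w) = ev (take j w) -> i = j.
Proof.
move=> gw si sj E; apply/eqP; rewrite eqn_leq.
have gi := @gword_take i _ gw; have gj := @gword_take j _ gw.
move: (gi _ (esym E)) (gj _ E); rewrite !size_takel // => -> ->.
by [].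
Qed.

(** A prefix of a geodesic word is geodesic, and the prefix of [v] followed by the connecting word
    is a competitor of length at most [j + k]. *)
Lemma gword_near w i v j k : gword w -> i <= size w ->
  near k (ev (take j v)) (ev (take i w)) -> i <= j + k.
Proof.
move=> gw si [t tk E].
have := @gword_take i _ gw (take j v ++ t); rewrite eval_cat => /(_ E).
rewrite size_takel // size_cat size_take; case: ifP; lia.
Qed.

Lemma uniq_vertices x w I : left_cancellative mul -> gword w -> uniq I ->
  (forall i, i \in I -> i <= size w) -> uniq [seq x ** ev (take i w) | i <- I].
Proof.
move=> lc gw UI leI; rewrite map_inj_in_uniq // => i j Ii Ij /lc.
by apply: gword_take_inj; rewrite ?leI.
Qed.

(** There are finitely many connecting words of length at most [k], and each has bounded fibres. *)
Lemma inball_bounded (k : nat) :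
  (forall x, exists N, fibre_le x N) ->
  exists N, forall y s, uniq s -> (forall x, x \in s -> near k x y) -> size s <= N.
Proof.
move=> fib.
have [N HN] : exists N, forall t : k.-bseq B, fibre_le (ev t) N.
  apply: finite_bound => [t m n|t]; first exact: fibre_le_mono.
  exact: fib.
exists (size (enum {: k.-bseq B}) * N) => y s Us Hs.
apply: (@pigeonhole _ _ (fun x (t : k.-bseq B) => x ** ev t = y)) => //.
  by move=> x /Hs [t tk E]; exists (Bseq tk); rewrite ?mem_enum.
by move=> t s' Us' _; apply: HN.
Qed.

Lemma outball_bounded (k : nat) :
  exists N, forall y s, uniq s -> (forall x, x \in s -> near k y x) -> size s <= N.
Proof.
exists (size (enum {: k.-bseq B}) * 1) => y s Us Hs.
apply: (@pigeonhole _ _ (fun x (t : k.-bseq B) => y ** ev t = x)) => //.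
  by move=> x /Hs [t tk E]; exists (Bseq tk); rewrite ?mem_enum.
move=> t [|z1 [|z2 s']] //= /andP[]; rewrite inE => /norP[/eqP ne _] _ _ H.
by case: ne; apply: etrans (esym (H z1 _)) (H z2 _); rewrite !inE eqxx ?orbT.
Qed.

Section Paths.

Fixpoint verts x (w : seq B) :=
  if w is b :: w' then x ** genB b :: verts (x ** genB b) w' else [::].

Lemma size_verts x w : size (verts x w) = size w.
Proof. by elim: w x => //= b w IH x; rewrite IH. Qed.

Lemma last_verts x w : last x (verts x w) = x ** ev w.
Proof. by elim: w x => [|b w IH] x /=; rewrite ?mx1 // IH mA. Qed.

Lemma cay_path_verts x w : cay_path mul genB x (verts x w).
Proof. by elim: w x => //= b w IH x; split=> //; exists b. Qed.

Lemma cay_pathP x s : cay_path mul genB x s -> exists w, s = verts x w.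
Proof.
elim: s x => [|y s IH] x /=; first by exists [::].
by move=> [[b <-] /IH[w ->]]; exists (b :: w).
Qed.

Lemma dist_leP u v k : dist_le mul genB u v k <-> near k u v.
Proof.
split=> [[s [/cay_pathP[w ->] [<- sz]]]|[t tk <-]].
  by exists w; rewrite -?(size_verts u) // last_verts.
exists (verts u t); rewrite last_verts size_verts; split=> //.
exact: cay_path_verts.
Qed.

Lemma In_verts x w v : List.In v (x :: verts x w) <->
  exists2 i, i <= size w & v = x ** ev (take i w).
Proof.
elim: w x => [|b w IH] x.
  split=> [[<-|//]|[[|i] // _ ->]]; first by exists 0; rewrite ?mx1.
  by left; rewrite mx1.
split=> [[<-|H]|[[|i] si Ev]].
- by exists 0; rewrite ?mx1.
- have [i si ->] := (IH (x ** genB b)).1 H.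
  by exists i.+1 => //=; rewrite mA.
- by left; rewrite Ev mx1.
- by right; apply: (IH (x ** genB b)).2; exists i => //=; rewrite Ev /= mA.
Qed.

Lemma geodesic_verts x w : left_cancellative mul -> gword w ->
  geodesic mul genB x (verts x w).
Proof.
move=> lc gw; split; first exact: cay_path_verts.
move=> t /cay_pathP[w' ->]; rewrite !last_verts !size_verts => /lc.
exact: gw.
Qed.

End Paths.

(** * Consequences of thin triangles *)

Hypothesis lc : left_cancellative mul.
Hypothesis GenB : generates mul one genB.
Hypothesis fib : forall x, exists N, fibre_le x N.
Variable d : nat.
Hypothesis hyp : strongly_hyperbolic_graph mul genB d.

Lemma thin_words p q r : gword p -> gword q -> gword r -> ev p ** ev q = ev r ->
  [/\ forall j, j <= size r ->
       (exists2 i, i <= size p & near d (ev (take i p)) (ev (take j r))) \/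
       (exists2 k, k <= size q & near d (ev (take j r)) (ev p ** ev (take k q))),
      forall i, i <= size p ->
       (exists2 j, j <= size r & near d (ev (take j r)) (ev (take i p))) \/
       (exists2 k, k <= size q & near d (ev (take i p)) (ev p ** ev (take k q))) &
      forall k, k <= size q ->
       (exists2 i, i <= size p & near d (ev (take i p)) (ev p ** ev (take k q))) \/
       (exists2 j, j <= size r & near d (ev p ** ev (take k q)) (ev (take j r)))].
Proof.
move=> gp gq gr E.
have [|T1 T2 T3] := hyp (px := one) (ps := verts one p) (qx := ev p)
  (qs := verts (ev p) q) (rx := one) (rs := verts one r).
  by split; split=> //; rewrite ?last_verts ?m1x //; apply: geodesic_verts.
have inV x w i : i <= size w -> List.In (x ** ev (take i w)) (x :: verts x w).
  by move=> ?; apply/In_verts; exists i.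
split=> i si.
- have [[z [/In_verts[k sk ->] /dist_leP H]]|[z [/In_verts[k sk ->] /dist_leP H]]] :=
    T1 _ (inV one r i si); [left|right]; exists k => //; by rewrite ?m1x in H.
- have [[z [/In_verts[k sk ->] /dist_leP H]]|[z [/In_verts[k sk ->] /dist_leP H]]] :=
    T2 _ (inV one p i si); [left|right]; exists k => //; by rewrite ?m1x in H.
- have [[z [/In_verts[k sk ->] /dist_leP H]]|[z [/In_verts[k sk ->] /dist_leP H]]] :=
    T3 _ (inV _ q i si); [left|right]; exists k => //; by rewrite ?m1x in H.
Qed.

(** In a directed graph [c] cannot be walked backwards, so this needs thinness. A vertex of [p]
    beyond index [size r + d] is too deep to be reached from [r] within [d]; it is therefore close
    to the short side, hence in the in-ball of radius [d + k] around [ev r], which has at most [N]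
    elements. *)
Lemma right_mul_length k : exists C, forall p c r, gword p -> gword r ->
  size c <= k -> ev r = ev p ** ev c -> size p <= size r + C.
Proof.
have [N HN] := inball_bounded (d + k) fib.
exists (d + N) => p c r gp gr ck Er.
have [q gq Eq] := gword_exists GenB (ev c).
have qk : size q <= k by apply: leq_trans ck; apply: gq.
have [_ T2 _] := thin_words gp gq gr (etrans (congr1 _ Eq) (esym Er)).
pose I := iota (size r + d).+1 (size p - (size r + d)).
have leI i : i \in I -> i <= size p by rewrite mem_iota; lia.
have : size [seq one ** ev (take i p) | i <- I] <= N.
  apply: (HN (ev r)); first by apply: uniq_vertices => //; apply: iota_uniq.
  move=> _ /mapP[i Ii ->]; rewrite m1x.
  have [[j sj H]|[j sj H]] := T2 i (leI i Ii).
    have := gword_near gp (leI _ Ii) H; move: Ii; rewrite mem_iota; lia.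
  apply: near_trans H _; rewrite Er -Eq; apply: near_mull.
  by apply: near_end; lia.
by rewrite size_map size_iota; lia.
Qed.

(** The vertex of [r] slightly before [j] lies near some vertex [i] of [p]. [gword_near] bounds [i]
    from below and [right_mul_length] from above, so walking along [p] from [j - C] to [i], across,
    and along [r] to [j] has bounded length. *)
Lemma lagging_geodesics k : exists C D, forall p c r, gword p -> gword r ->
  size c <= k -> ev r = ev p ** ev c ->
  forall j, j <= size r -> near D (ev (take (j - C) p)) (ev (take j r)).
Proof.
have [CA HA] := right_mul_length d.
exists (d + (d + k).+1), (CA + (d + (d + k).+1) + d + (d + k).+1).
move=> p c r gp gr ck Er j sj.
have [q gq Eq] := gword_exists GenB (ev c).
have qk : size q <= k by apply: leq_trans ck; apply: gq.
have [T1 _ _] := thin_words gp gq gr (etrans (congr1 _ Eq) (esym Er)).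
(* Stepping back by [d + k + 1] puts the vertex too far from the end of [r] to be near the short
   side [q]. If the truncated difference is [0], the common start vertex serves instead. *)
pose j0 := j - (d + k).+1.
have sj0 : j0 <= size r by rewrite /j0; lia.
have [i si H] : exists2 i, i <= size p & near d (ev (take i p)) (ev (take j0 r)).
  have [->|j0_gt0] := posnP j0.
    by exists 0; rewrite ?take0 //; apply: near_refl.
  have [//|[i si H]] := T1 j0 sj0.
  have : near (d + k) (ev (take j0 r)) (ev (take (size r) r)).
    rewrite take_size; apply: near_trans H _; rewrite Er -Eq; apply: near_mull.
    by apply: near_end; lia.
  by move/(gword_near gr (leqnn _)); rewrite /j0 in j0_gt0 *; lia.
have le1 := gword_near gr sj0 H.
have le2 : i <= j0 + CA.
  have [t td E] := H.
  have := HA _ _ _ (@gword_take i _ gp) (@gword_take j0 _ gr) td (esym E).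
  by rewrite !size_takel.
apply: (@near_trans (CA + (d + (d + k).+1) + d) _ _ (ev (take j0 r))).
  by apply: (near_trans _ H); apply: near_take; rewrite /j0 in le1 le2; lia.
by apply: near_take; rewrite /j0; lia.
Qed.


Lemma size_le_split (T : eqType) (P Q : T -> Prop) (s : seq T) a b :
  uniq s -> (forall x, x \in s -> P x \/ Q x) ->
  (forall s', uniq s' -> {subset s' <= s} -> (forall x, x \in s' -> P x) -> size s' <= a) ->
  (forall s', uniq s' -> {subset s' <= s} -> (forall x, x \in s' -> Q x) -> size s' <= b) ->
  size s <= a + b.
Proof.
move=> Us PQ Ha Hb; pose f x := `[< P x >].
rewrite -(count_predC f s) -!size_filter; apply: leq_add.
  apply: Ha; rewrite ?filter_uniq // => x; rewrite mem_filter; first by case/andP.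
  by case/andP=> /asboolP.
apply: Hb; rewrite ?filter_uniq // => x; rewrite mem_filter; first by case/andP.
by case/andP=> /= /asboolPn nP /PQ[].
Qed.

(** Each vertex of the side [q] lies in an out-ball around a vertex of [p] or an in-ball around a
    vertex of [r]. Both kinds of ball are bounded, so the vertices can be counted. *)
Lemma quotient_length : exists C, forall p q r, gword p -> gword q -> gword r ->
  ev r = ev p ** ev q -> size q <= C * (size p + size r + 1).
Proof.
have [N1 H1] := outball_bounded d; have [N2 H2] := inball_bounded d fib.
exists (N1 + N2) => p q r gp gq gr E.
have [_ _ T3] := thin_words gp gq gr (esym E).
pose s := [seq ev p ** ev (take k q) | k <- iota 0 (size q).+1].
have leI k : k \in iota 0 (size q).+1 -> k <= size q by rewrite mem_iota; lia.
have Us : uniq s by apply: uniq_vertices => //; apply: iota_uniq.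
have : size s <= size (iota 0 (size p).+1) * N1 + size (iota 0 (size r).+1) * N2.
  apply: (@size_le_split _
      (fun x => exists2 i, i <= size p & near d (ev (take i p)) x)
      (fun x => exists2 j, j <= size r & near d x (ev (take j r)))) => //.
  - by move=> _ /mapP[k Ik ->]; apply: T3; apply: leI.
  - move=> s' Us' _ Hs'.
    apply: (@pigeonhole _ _ (fun x i => near d (ev (take i p)) x)) => //.
      by move=> x /Hs'[i si H]; exists i => //; rewrite mem_iota; lia.
    by move=> i s'' Us'' _; apply: H1.
  - move=> s' Us' _ Hs'.
    apply: (@pigeonhole _ _ (fun x j => near d x (ev (take j r)))) => //.
      by move=> x /Hs'[i si H]; exists i => //; rewrite mem_iota; lia.
    by move=> i s'' Us'' _; apply: H2.
rewrite size_map !size_iota => H; apply: ltnW; apply: leq_trans H _.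
rewrite mulnDl; apply: leq_add; rewrite mulnC leq_mul2l; lia.
Qed.

Section FactorClosed.
Variable U : M -> Prop.
Hypothesis U_mul : forall x y, U x -> U y -> U (x ** y).
Hypothesis U_fac : forall x y, U (x ** y) -> U x /\ U y.

Definition U_rel x y := exists p q, [/\ U p, U q & x = p ** y ** q].

Lemma U_take i w : U (ev w) -> U (ev (take i w)).
Proof. by rewrite -{1}(cat_take_drop i w) eval_cat => /U_fac[]. Qed.

Lemma U_drop i w : U (ev w) -> U (ev (drop i w)).
Proof. by rewrite -{1}(cat_take_drop i w) eval_cat => /U_fac[]. Qed.

(** Take [a] shortest. Its vertices beyond [size r + d] are near a vertex of the geodesic [h] for
    [b c]. Such a vertex of [h] is either near [b], hence of index at most [size b + d], or near the
    part labelled [c]; the first case is bounded by in-balls, the second by minimality of [a]. *)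
Lemma left_factor_length : exists C, forall r b, gword r -> gword b ->
  U_rel (ev r) (ev b) -> exists a c, [/\ U (ev a), U (ev c),
    ev r = ev a ** ev b ** ev c & size a <= C * (size r + size b + 1)].
Proof.
have [N HN] := inball_bounded d fib.
(* The number of connecting words across two thin triangles. *)
pose W := size (enum {: (d + d).-bseq B}).
exists (1 + d + W + N * (d + 1)) => r b gr gb [p0 [q0 [Up0 Uq0 E0]]].
pose good n := exists a c, [/\ U (ev a), U (ev c), ev r = ev a ** ev b ** ev c & size a = n].
have ex : exists n, `[< good n >].
  have [a Ea] := GenB p0; have [c Ec] := GenB q0.
  by exists (size a); apply/asboolP; exists a, c; rewrite -Ea -Ec.
case: (ex_minnP ex) => _ /asboolP[a [c0 [Ua Uc0 E1 <-]]] min {p0 q0 Up0 Uq0 E0 ex}.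
have {}min a' c' : U (ev a') -> U (ev c') -> ev r = ev a' ** ev b ** ev c' ->
    size a <= size a'.
  by move=> *; apply: min; apply/asboolP; exists a', c'.
have [c gc Ec] := gword_exists GenB (ev c0).
have Uc : U (ev c) by rewrite Ec.
have {E1} Er : ev r = ev a ** ev b ** ev c by rewrite Ec.
exists a, c; split=> //.
(* Another word for [ev a] is a competitor with the same right factor [c]. *)
have ga : gword a.
  by move=> a' Ea'; apply: (min a' c); rewrite ?Ea'.
have [h gh Eh] := gword_exists GenB (ev b ** ev c).
have [_ T2 _] := thin_words ga gh gr (etrans (congr1 _ Eh) (etrans (mA _ _ _) (esym Er))).
have [T1 _ _] := thin_words gb gc gh (esym Eh).
pose I := iota (size r + d).+1 (size a - (size r + d)).
have leI i : i \in I -> i <= size a by rewrite mem_iota; lia.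
have : size I <= size (iota 0 (size b + d).+1) * N + W * 1.
  apply: (@size_le_split _
    (fun i => exists2 k, k <= size b + d &
                near d (ev (take i a)) (ev a ** ev (take k h)))
    (fun i => exists2 l, l <= size c &
                near (d + d) (ev (take i a)) (ev a ** (ev b ** ev (take l c))))).
  - exact: iota_uniq.
  - move=> i Ii; have [[j sj H]|[k sk H]] := T2 i (leI i Ii).
      have := gword_near ga (leI _ Ii) H; move: Ii; rewrite mem_iota; lia.
    have [[l sl H']|[l sl H']] := T1 k sk.
      left; exists k => //; have := gword_near gh sk H'; lia.
    by right; exists l => //; apply: near_trans H (near_mull _ H').
  - move=> s Us sub Hs.
    apply: (@pigeonhole _ _ (fun i k => near d (ev (take i a)) (ev a ** ev (take k h)))) => //.
      by move=> x /Hs[i si H]; exists i => //; rewrite mem_iota; lia.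
    move=> k s' Us' sub' Hs'.
    have := HN (ev a ** ev (take k h)) [seq one ** ev (take i a) | i <- s'].
    rewrite size_map; apply; first by apply: uniq_vertices => // i /sub' /sub /leI.
    by move=> _ /mapP[i si ->]; rewrite m1x; apply: Hs'.
  - move=> s Us sub Hs.
    apply: (@pigeonhole _ _ (fun i (t : (d + d).-bseq B) => exists2 l, l <= size c &
      ev (take i a) ** ev t = ev a ** (ev b ** ev (take l c)))) => //.
      by move=> i /Hs[l sl [t td Et]]; exists (Bseq td); rewrite ?mem_enum //; exists l.
    move=> t s' Us' sub' Hs'.
    (* Two indices with the same [t] would allow a shorter left factor. *)
    have shorten i j : i \in s' -> j \in s' -> i < j -> False.
      move=> si sj lt_ij.
      have tE k l : ev (take k a) ** ev t = ev a ** (ev b ** ev (take l c)) ->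
          ev t = ev (drop k a) ** (ev b ** ev (take l c)).
        move=> E; apply: (@lc (ev (take k a))).
        by rewrite E -{1}(cat_take_drop k a) eval_cat -!mA.
      have [l sl /tE El] := Hs' _ si; have [m sm /tE Em] := Hs' _ sj.
      have sja := leI j (sub j (sub' j sj)).
      (* The segment of [a] between [i] and [j] is cut out. By [Em] the word [t] equals [drop j a],
         then [b], then [take m c], and by [El] following [t] with [drop l c] completes [take i a]
         to [r]. Closure under factors and products keeps both new factors in [U]. *)
      have := min (take i a ++ drop j a) (take m c ++ drop l c).
      rewrite !eval_cat; move/(_ (U_mul (U_take _ Ua) (U_drop _ Ua))).
      move/(_ (U_mul (U_take _ Uc) (U_drop _ Uc))).
      have -> : ev (take i a) ** ev (drop j a) ** ev b ** (ev (take m c) ** ev (drop l c))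
              = ev (take i a) ** ev t ** ev (drop l c) by rewrite Em !mA.
      have -> : ev (take i a) ** ev t ** ev (drop l c) = ev r.
        by rewrite El Er -[in RHS](cat_take_drop i a) -[in RHS](cat_take_drop l c) !eval_cat !mA.
      by move/(_ erefl); rewrite size_cat size_takel ?size_drop; lia.
    case: s' Us' {sub'} Hs' shorten => [|i [|j s']] //= /andP[]; rewrite inE.
    case/norP=> ne _ _ _ shorten; exfalso; case: (ltngtP i j) => [lt|lt|E].
    + by apply: shorten lt; rewrite !inE eqxx ?orbT.
    + by apply: shorten lt; rewrite !inE eqxx ?orbT.
    + by rewrite E eqxx in ne.
rewrite !size_iota; move: (size a) (size r) (size b) => x y z.
rewrite muln1 => H.
apply: (@leq_trans ((y + d) + ((z + d).+1 * N + W))); first lia.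
clear; nia.
Qed.

(** Only the left factor was minimised, so [c] may be replaced by a geodesic word; [quotient_length]
    bounds it in the triangle with sides [a b], [c] and [r]. *)
Lemma factor_length : exists C, forall r b, gword r -> gword b ->
  U_rel (ev r) (ev b) -> exists a c, [/\ U (ev a), U (ev c),
    ev r = ev a ** ev b ** ev c, size a <= C * (size r + size b + 1) &
    size c <= C * (size r + size b + 1)].
Proof.
have [C1 H1] := left_factor_length; have [C2 H2] := quotient_length.
exists (C1 + C2 * (C1 + 1)) => r b gr gb /(H1 _ _ gr gb)[a [c [Ua Uc E sa]]].
have [c' gc' Ec'] := gword_exists GenB (ev c).
exists a, c'; rewrite Ec'; split=> //.
  by apply: leq_trans sa _; rewrite leq_mul2r leq_addr orbT.
have [p gp Ep] := gword_exists GenB (ev a ** ev b).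
have := H2 p c' r gp gc' gr; rewrite Ep Ec' => /(_ E) sc.
have : size p <= size a + size b.
  by rewrite -size_cat; apply: gp; rewrite eval_cat Ep.
move: sa sc; move: (size a) (size b) (size c') (size p) (size r) => x y z t w H3 H4 H5.
apply: leq_trans H4 _.
apply: (@leq_trans (C2 * ((C1 + 1) * (w + y + 1)))); first by rewrite leq_mul2l; nia.
by rewrite mulnA leq_mul2r leq_addl orbT.
Qed.

End FactorClosed.

End Monoid.

(** * Rewriting a word to a geodesic *)

Section Tracks.
Variables (M : eqType) (mul : M -> M -> M) (one : M).
Hypothesis mon : is_monoid mul one.
Local Notation "x ** y" := (mul x y) (at level 40, left associativity).
Variables (B : finType) (genB : B -> M) (K : nat).
Local Notation ev := (eval_word mul one genB).

Local Notation letter := (K.-bseq B).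
Local Notation eps := ([bseq] : letter).
(** A word longer than [K] is sent to the empty word, so every use has to check the length. *)
Definition pack (w : seq B) : letter := insub_bseq K w.
Definition single (b : B) : letter := pack [:: b].

Local Notation evs := (eval_word mul one (fun c : letter => ev c)).

Definition same_value (a b a' b' : letter) := ev a ** ev b = ev a' ** ev b'.

Lemma packE w : size w <= K -> pack w = w :> seq B.
Proof. by move=> wK; rewrite /pack insubdK. Qed.

Lemma pack_val (c : letter) : pack c = c.
Proof. by apply: val_inj; apply: packE; apply: size_bseq. Qed.

Lemma evs_single w : 0 < K -> evs (map single w) = ev w.
Proof. by move=> K0; elim: w => //= b w ->; rewrite packE //= (mx1 mon). Qed.

Lemma evs_flatten x : ev (flatten (map val x)) = evs x.
Proof. by elim: x => //= c x IH; rewrite (eval_cat mon) IH. Qed.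

Lemma evs_eps n x : evs (nseq n eps ++ x) = evs x.
Proof. by elim: n => //= n ->; rewrite (m1x mon). Qed.

Lemma shift_right x : rewrites same_value (size x) (eps :: x) (rcons x eps).
Proof.
elim: x => [|c x IH]; first exact: steps_refl.
apply: (@steps_cons _ _ _ _ (c :: eps :: x)).
  by apply: (@RStep _ _ [::] x); rewrite /same_value /= (m1x mon) (mx1 mon).
exact: (rewrites_ctxl [:: c] IH).
Qed.

Lemma shift_left x : rewrites same_value (size x) (rcons x eps) (eps :: x).
Proof.
elim: x => [|c x IH]; first exact: steps_refl.
rewrite [size _]/= -addn1; apply: steps_trans (rewrites_ctxl [:: c] IH) _.
by apply: (@rewrites_rule _ _ [::] x); rewrite /same_value /= (m1x mon) (mx1 mon).
Qed.

Lemma shift_right_n k x :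
  rewrites same_value (k * size x) (nseq k eps ++ x) (x ++ nseq k eps).
Proof.
elim: k => [|k IH]; first by rewrite cats0; apply: steps_refl.
rewrite mulSn addnC; apply: steps_trans (rewrites_ctxl [:: eps] IH) _.
have := rewrites_ctxr (nseq k eps) (shift_right x).
by rewrite cat_rcons.
Qed.

Lemma shift_left_n k x :
  rewrites same_value (k * size x) (x ++ nseq k eps) (nseq k eps ++ x).
Proof.
elim: k => [|k IH]; first by rewrite cats0; apply: steps_refl.
rewrite mulSn.
have := rewrites_ctxr (nseq k eps) (shift_left x); rewrite cat_rcons => H.
exact: steps_trans H (rewrites_ctxl [:: eps] IH).
Qed.

(** Rewriting preserves length, so a word of varying length is kept at the right end of a track of
    fixed length [T]. *)
Definition pad T (x : seq letter) := nseq (T - size x) eps ++ x.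

(** Local moves that may change the length; [Z] records the space they use, so that [pad_wstep] can
    realise them on a fixed track. *)
Inductive wstep Z : seq letter -> seq letter -> Prop :=
  WStep P Q Q' S : size Q <= 2 -> size Q' <= 2 -> evs Q = evs Q' ->
    size (P ++ Q ++ S) <= Z -> size (P ++ Q' ++ S) <= Z ->
    wstep Z (P ++ Q ++ S) (P ++ Q' ++ S).

Lemma wstep_ctx Z Z' P S x y : Z + size P + size S <= Z' ->
  wstep Z x y -> wstep Z' (P ++ x ++ S) (P ++ y ++ S).
Proof.
move=> le_Z [P1 Q Q' S1 sQ sQ' E sx sy].
have eqc q : P ++ (P1 ++ q ++ S1) ++ S = (P ++ P1) ++ q ++ (S1 ++ S) by rewrite -!catA.
rewrite !eqc; constructor=> //; rewrite -eqc !size_cat in sx sy *; lia.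
Qed.

Lemma wsteps_ctx Z Z' P S n x y : Z + size P + size S <= Z' ->
  steps (wstep Z) n x y -> steps (wstep Z') n (P ++ x ++ S) (P ++ y ++ S).
Proof.
move=> le_Z; apply: (steps_homo (f := fun v => P ++ v ++ S)) => v v'.
exact: wstep_ctx.
Qed.

(** Spare empty letters are moved from the left through [P] until the window [Q] has exactly two
    letters; one rule replaces it, and the empty letters left over travel back. The two extra cells
    guarantee enough spares. *)
Lemma pad_wstep Z T x y : Z + 2 <= T -> wstep Z x y ->
  rewrites same_value (4 * T + 1) (pad T x) (pad T y).
Proof.
move=> le_Z [P Q Q' S sQ sQ' E sx sy].
pose a := T - (size P + size S + 2).
have padE q : size q <= 2 -> size (P ++ q ++ S) <= Z ->
    pad T (P ++ q ++ S) = nseq a eps ++ (nseq (2 - size q) eps ++ P) ++ q ++ S.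
  move=> sq sz; rewrite /pad !catA -nseqD -!catA; congr (nseq _ _ ++ _).
  by rewrite /a !size_cat in sz *; lia.
have le_P q : size q <= 2 -> size (P ++ q ++ S) <= Z -> (2 - size q) * size P <= 2 * T.
  by rewrite !size_cat => sq sz; apply: leq_mul; lia.
have step1 := rewrites_ctx (nseq a eps) (Q ++ S) (shift_right_n (2 - size Q) P).
have step3 := rewrites_ctx (nseq a eps) (Q' ++ S) (shift_left_n (2 - size Q') P).
rewrite padE // padE //.
have -> : 4 * T + 1 = 2 * T + (1 + 2 * T) by lia.
apply: steps_trans (steps_le (le_P _ sQ sx) step1) _.
apply: steps_trans (steps_le (le_P _ sQ' sy) step3).
have window q : size q <= 2 -> exists c1 c2,
    nseq (2 - size q) eps ++ q = [:: c1; c2] /\ ev c1 ** ev c2 = evs q.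
  case: q => [|c1 [|c2 [|c3 q]]] //= _.
  - by exists eps, eps; rewrite /= (m1x mon).
  - by exists eps, c1; rewrite /= (m1x mon) (mx1 mon).
  - by exists c1, c2; rewrite /= (mx1 mon).
have [c1 [c2 [E12 V]]] := window Q sQ; have [c1' [c2' [E12' V']]] := window Q' sQ'.
rewrite -!catA (catA _ Q S) (catA _ Q' S) E12 E12' /= !(catA _ P).
by apply: rewrites_rule; rewrite /same_value V V'.
Qed.

Lemma pad_wsteps Z T n x y : Z + 2 <= T -> steps (wstep Z) n x y ->
  rewrites same_value (n * (4 * T + 1)) (pad T x) (pad T y).
Proof.
move=> le_Z; apply: (steps_expand (I := fun=> True)) => // v v' _ S.
by split=> //; apply: pad_wstep S.
Qed.

Local Notation gword := (gword mul one genB).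
Local Notation near := (near mul one genB).

Hypothesis lc : left_cancellative mul.
Hypothesis GenB : generates mul one genB.
Variables k CA C D : nat.
Hypothesis HA : forall p c r, gword p -> gword r -> size c <= k ->
  ev r = ev p ** ev c -> size p <= size r + CA.
Hypothesis HL : forall p c r, gword p -> gword r -> size c <= k ->
  ev r = ev p ** ev c ->
  forall j, j <= size r -> near D (ev (take (j - C) p)) (ev (take j r)).
Hypothesis HK : CA + C + k + D < K.

Lemma merge Z s (c : letter) : size s + size c <= K -> size s < Z ->
  steps (wstep Z) (size s) (map single s ++ [:: c]) [:: pack (s ++ c)].
Proof.
elim: s Z => [|b s IH] [|Z] //= sK sZ; first by rewrite pack_val; apply: steps_refl.
rewrite -[(size s).+1]addn1; apply: (@steps_trans _ _ _ _ _ [:: single b; pack (s ++ c)]).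
  have := @wsteps_ctx Z Z.+1 [:: single b] [::] _ _ _ _ (IH Z _ _).
  by rewrite !cats0; apply => //; rewrite ?addn1 ?addn0 //; lia.
apply: steps1.
apply: (@WStep _ [::] [:: single b; pack (s ++ c)] [:: pack (b :: s ++ c)] [::]) => //=; try lia.
rewrite !(mx1 mon) !packE /= ?(mx1 mon) ?size_cat //; lia.
Qed.

(** The end of [p] and [c] are merged into one letter of length at most [CA + C + k], which is
    exchanged for a connecting word of length at most [D]. This letter then sweeps left, turning [p]
    into [r] behind it, and is finally erased. [HK] makes all these words fit into a letter. *)
Lemma extend_geodesic Z p (c : letter) r : gword p -> gword r -> size c <= k ->
  ev r = ev p ** ev c -> size p < Z -> size r < Z ->
  steps (wstep Z) (CA + C + size r + 2) (map single p ++ [:: c]) (map single r).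
Proof.
move=> gp gr ck Er sp sr; have K_gt0 : 0 < K by lia.
have /choice[e He] : forall j, exists e, j <= size r ->
    size e <= D /\ ev (take (j - C) p) ** ev e = ev (take j r).
  move=> j; have [/(HL gp gr ck Er)[e eD E]|] := leqP j (size r); first by exists e.
  by exists [::].
(* The sweep at position [j]: a lagging prefix of [p], the connecting word, and the part of [r]
   already produced. *)
pose st j := map single (take (j - C) p) ++ pack (e j) :: map single (drop j r).
have st_size j : j <= size r -> size (st j) <= Z.
  move=> jr; rewrite size_cat /= !size_map size_drop.
  have : size (take (j - C) p) <= j - C by rewrite size_take; case: ifP; lia.
  by lia.
have ev_pack j : j <= size r -> ev (pack (e j)) = ev (e j).
  by move=> jr; rewrite packE //; have [] := He j jr; lia.
have sweep j : j <= size r -> steps (wstep Z) j (st j) (st 0).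
  elim: j => [|j IH] jr; first exact: steps_refl.
  apply: (steps_cons _ (IH (ltnW jr))).
  have := st_size j (ltnW jr); have := st_size j.+1 jr.
  pose P := map single (take (j - C) p).
  have ET : take (j.+1 - C) p = take (j - C) p ++ drop (j - C) (take (j.+1 - C) p).
    by apply: take_split; lia.
  (* At most one letter; none while [j < C], where truncated subtraction makes both prefixes of [p]
     empty. *)
  set ys := drop _ _ in ET.
  have sys : size ys <= 1 by rewrite size_drop size_take; case: ifP; lia.
  have b : B by case: (r) jr.
  have ED : drop j r = nth b r j :: drop j.+1 r by rewrite (drop_nth b).
  have -> : st j.+1 = P ++ (map single ys ++ [:: pack (e j.+1)]) ++ map single (drop j.+1 r).
    by rewrite /st ET map_cat -!catA.
  have -> : st j = P ++ [:: pack (e j); single (nth b r j)] ++ map single (drop j.+1 r).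
    by rewrite /st ED.
  move=> sz1 sz0; constructor=> //.
    by rewrite size_cat size_map addn1.
  rewrite (eval_cat mon) evs_single //= !(mx1 mon) !ev_pack //; last exact: ltnW.
  (* After the prefix of [p], both windows lead to the vertex [ev (take j.+1 r)]; left cancellation
     removes the prefix. *)
  rewrite packE //= (mx1 mon); apply: (@lc (ev (take (j - C) p))).
  rewrite !(mA mon) -(eval_cat mon) -ET.
  have [_ ->] := He _ jr; have [_ ->] := He _ (ltnW jr).
  by rewrite (take_nth b) // (eval_rcons mon).
have le_p := HA gp gr ck Er.
have sd : size (drop (size r - C) p) <= CA + C by rewrite size_drop; lia.
have eqE : CA + C + size r + 2 = (CA + C) + (1 + (size r + 1)) by lia.
rewrite eqE; apply: (@steps_trans _ _ _ _ _
  (map single (take (size r - C) p) ++ [:: pack (drop (size r - C) p ++ c)])).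
  rewrite -{1}(cat_take_drop (size r - C) p) map_cat -catA.
  have H := @merge (size (drop (size r - C) p)).+1 (drop (size r - C) p) c.
  have := @wsteps_ctx _ Z (map single (take (size r - C) p)) [::] _ _ _ _ (H _ _).
  rewrite !cats0 => H'; apply: (steps_le sd (H' _ _ _)) => //; last by lia.
  rewrite addn0 size_map addSn addnC -size_cat cat_take_drop; lia.
apply: (@steps_trans _ _ _ _ _ (st (size r))).
  apply: steps1; rewrite /st drop_size.
  have [eD Ee] := He _ (leqnn (size r)).
  have sz : size (map single (take (size r - C) p)) < Z.
    by rewrite size_map size_take; case: ifP; lia.
  have := @WStep Z (map single (take (size r - C) p)) [:: pack (drop (size r - C) p ++ c)]
    [:: pack (e (size r))] [::].
  rewrite !cats0; apply; rewrite ?size_cat ?addn1 //=.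
  rewrite !(mx1 mon) ev_pack // packE ?size_cat; last by lia.
  apply: (@lc (ev (take (size r - C) p))).
  by rewrite Ee take_size (eval_cat mon) (mA mon) -(eval_cat mon) cat_take_drop.
apply: steps_trans (sweep _ (leqnn _)) _; apply: steps1.
have := st_size 0 (leq0n _); rewrite /st sub0n take0 drop0 => sz.
apply: (@WStep _ [::] [:: pack (e 0)] [::] (map single r)) => //=; last by rewrite size_map ltnW.
(* Both prefixes are empty at [0], so the connecting word has value [one]. *)
have [_ E0] := He 0 (leq0n _).
by rewrite (mx1 mon) ev_pack //; move: E0; rewrite sub0n !take0 /= (m1x mon).
Qed.

Lemma gword_size_le (x : seq letter) r : (forall c, c \in x -> size c <= k) ->
  gword r -> ev r = evs x -> size r <= k * size x.
Proof.
move=> Hx gr Er; apply: (@leq_trans (size (flatten (map val x)))).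
  by apply: gr; rewrite Er evs_flatten.
elim: x Hx {gr Er} => //= c x IH Hx; rewrite size_cat mulnS; apply: leq_add.
  by apply: Hx; rewrite mem_head.
by apply: IH => c' cx; apply: Hx; rewrite inE cx orbT.
Qed.

(** One call of [extend_geodesic] per letter, with intermediate geodesics of length at most
    [k * n]. *)
Definition cost n := n * (CA + C + k * n + 2).

(** Letters are absorbed from left to right: the prefix is made geodesic, then extended by the last
    letter. *)
Lemma normalise Z (x : seq letter) r : (forall c, c \in x -> size c <= k) ->
  gword r -> ev r = evs x -> k * size x + size x < Z ->
  steps (wstep Z) (cost (size x)) x (map single r).
Proof.
elim/last_ind: x Z r => [|x c IH] Z r Hx gr Er sZ.
  have := gword_size_le Hx gr Er; rewrite muln0.
  by case: (r) => //= _; apply: steps_refl.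
have Hx' c' : c' \in x -> size c' <= k.
  by move=> cx; apply: Hx; rewrite mem_rcons inE cx orbT.
have ck : size c <= k by apply: Hx; rewrite mem_rcons mem_head.
have [p gp Ep] := gword_exists GenB (evs x).
have sp := gword_size_le Hx' gp Ep; have sr := gword_size_le Hx gr Er.
rewrite size_rcons mulnS in sr sZ.
have H1 : steps (wstep Z) (cost (size x)) (x ++ [:: c]) (map single p ++ [:: c]).
  apply: (@wsteps_ctx Z.-1 _ [::]); first by rewrite /=; lia.
  apply: IH => //; lia.
have H2 : steps (wstep Z) (CA + C + size r + 2) (map single p ++ [:: c]) (map single r).
  apply: extend_geodesic => //; try lia.
  by rewrite Er (eval_rcons mon) Ep.
rewrite -cats1; apply: steps_le (steps_trans H1 H2).
rewrite /cost cats1 size_rcons mulSn addnC; apply: leq_add; first by rewrite mulnS; lia.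
by rewrite leq_mul2l mulnS; lia.
Qed.

Lemma normalise_pad T (x : seq letter) r : (forall c, c \in x -> size c <= k) ->
  gword r -> ev r = evs x -> k * size x + size x + 3 <= T ->
  rewrites same_value (cost (size x) * (4 * T + 1)) (pad T x) (pad T (map single r)).
Proof.
move=> Hx gr Er sT; apply: (@pad_wsteps (k * size x + size x).+1); first by lia.
exact: normalise.
Qed.

End Tracks.

(** * The rewriting system deciding [u = p v q] *)

(* A tape reads [cells, marker, raw input, blanks].  Input letters start as
   [Raw]; a [Cell] carries one letter of each of two words, the upper one coming
   from [u] and the lower one from the guessed product [p v q].  The marker moves
   through the phases [Front] (guess [p]), [Middle] (append [v]), [Back] (guess [q]),
   [Compare] (check that the two words agree) and [Done]. *)
Inductive symbol (A W : Type) :=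
| Raw of A | Cell of W & W | Blank | Front | Middle | Back | Compare | Done.
Arguments Blank {A W}. Arguments Front {A W}. Arguments Middle {A W}.
Arguments Back {A W}. Arguments Compare {A W}. Arguments Done {A W}.
Arguments Raw {A W}. Arguments Cell {A W}.

Section SymbolFinite.
Variables A W : finType.

Definition symbol_code (x : symbol A W) : A + W * W + 'I_6 :=
  match x with
  | Raw a => inl (inl a) | Cell t b => inl (inr (t, b))
  | Blank => inr (inord 0) | Front => inr (inord 1) | Middle => inr (inord 2)
  | Back => inr (inord 3) | Compare => inr (inord 4) | Done => inr (inord 5)
  end.

Definition symbol_decode (c : A + W * W + 'I_6) : symbol A W :=
  match c with
  | inl (inl a) => Raw a | inl (inr (t, b)) => Cell t b
  | inr i => nth Done [:: Blank; Front; Middle; Back; Compare] i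
  end.

Lemma symbol_codeK : cancel symbol_code symbol_decode.
Proof. by case=> //=; rewrite inordK. Qed.

HB.instance Definition _ := Countable.copy (symbol A W) (can_type symbol_codeK).
HB.instance Definition _ : isFinite (symbol A W) := CanIsFinite symbol_codeK.
End SymbolFinite.

Section Machine.
Variables (M : eqType) (mul : M -> M -> M) (one : M).
Hypothesis mon : is_monoid mul one.
Local Notation "x ** y" := (mul x y) (at level 40, left associativity).
Variables (A B : finType) (gen : A -> M) (genB : B -> M) (K : nat).
Local Notation ev := (eval_word mul one genB).
Local Notation evA := (eval_word mul one gen).
Local Notation letter := (K.-bseq B).
Local Notation eps := ([bseq] : letter).
Local Notation evs := (eval_word mul one (fun c : letter => ev c)).
Local Notation sym := (symbol A letter).
Variable phi : A -> letter.
Hypothesis phiE : forall a, ev (phi a) = gen a.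
Variable U : M -> Prop.
Hypothesis U_one : U one.
Hypothesis U_mul : forall x y, U x -> U y -> U (x ** y).
Hypothesis U_fac : forall x y, U (x ** y) -> U x /\ U y.

Definition inp (x : option A) : sym := if x is Some a then Raw a else Front.

Local Notation same := (same_value mul one genB (K := K)).

(** The predicates [same] and [U (ev b)] need not be computable: letters form a finite type, so the
    rules are a finite table. [mr_blank] keeps its left blank, which later shows [Compare] where the
    words begin. *)
Inductive mrule : sym -> sym -> sym -> sym -> Prop :=
| mr_cell t1 b1 t2 b2 t1' b1' t2' b2' :
    same t1 t2 t1' t2' -> same b1 b2 b1' b2' ->
    mrule (Cell t1 b1) (Cell t2 b2) (Cell t1' b1') (Cell t2' b2')
| mr_blank : mrule Blank Blank Blank (Cell eps eps)
| mr_raw a y : mrule (Raw a) y (Cell (phi a) eps) y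
| mr_front t (b : letter) : U (ev b) -> mrule (Cell t eps) Front (Cell t b) Front
| mr_front_middle t b : mrule (Cell t b) Front (Cell t b) Middle
| mr_middle a : mrule Middle (Raw a) (Cell eps (phi a)) Middle
| mr_middle_back : mrule Middle Blank Back Blank
| mr_back t (b : letter) : U (ev b) -> mrule (Cell t eps) Back (Cell t b) Back
| mr_back_compare t b : mrule (Cell t b) Back (Cell t b) Compare
| mr_compare t : mrule (Cell t t) Compare Compare (Cell eps eps)
| mr_done : mrule Blank Compare Blank Done.

(** * Soundness, by an invariant read backwards along a run *)

Section Soundness.

(** A marker or cell before the next blank gives [None], which excludes inputs with a second
    separator. *)
Fixpoint raw_value (w : seq sym) : option M :=
  match w with
  | [::] | Blank :: _ => Some one
  | Raw a :: w' => omap (mul (gen a)) (raw_value w')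
  | _ => None
  end.

(** The equation between upper value [t] and lower value [b] from which the phase [x] can still
    succeed, with the guesses yet to be made as existential factors. *)
Definition verdict (x : sym) (t b : M) (w : seq sym) : Prop :=
  match x with
  | Front => exists p y q, [/\ U p, U q, raw_value w = Some y & t = b ** p ** y ** q]
  | Middle => exists y q, [/\ U q, raw_value w = Some y & t = b ** y ** q]
  | Back => exists2 q, U q & t = b ** q
  | Compare => t = b
  | _ => False
  end.

(* [s] holds the values of the two words read since the last blank, or [None]
   once a marker has been passed. *)
Fixpoint good (s : option (M * M)) (w : seq sym) : Prop :=
  if w isn't x :: w' then False else
  match x with
  | Blank => good (Some (one, one)) w'
  | Raw a => good (omap (fun v => (v.1 ** gen a, v.2)) s) w'
  | Cell t b => good (omap (fun v => (v.1 ** ev t, v.2 ** ev b)) s) w'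
  | Done => True
  | _ => (if s is Some (t, b) then verdict x t b w' else False) \/ good None w'
  end.

(** A word containing [Done] is good, and goodness passes from the result of a rule to its source,
    hence back to the input. The second clause serves markers further left, whose verdict depends on
    the raw letters after them. *)
Definition pulls_back (w w' : seq sym) : Prop :=
  (forall s, good s w' -> good s w) /\
  (forall y, raw_value w' = Some y -> raw_value w = Some y).

Lemma pulls_back_cons x w w' : pulls_back w w' -> pulls_back (x :: w) (x :: w').
Proof.
move=> [H1 H2]; split=> [s|y].
  case: x => [a|t b||||||] /=; try exact: H1; try by [].
  - case=> [H|/H1]; [left|by right]; case: s H => [[t b]|] // [p [y [q [? ? /H2 ? ?]]]].
    by exists p, y, q.
  - case=> [H|/H1]; [left|by right]; case: s H => [[t b]|] // [y [q [? /H2 ? ?]]].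
    by exists y, q.
  - by case=> [|/H1]; [left|right].
  - by case=> [|/H1]; [left|right].
case: x => //= a; case E: (raw_value w') => [z|] //=.
by rewrite (H2 _ E).
Qed.

Lemma pulls_back_rule x y x' y' S :
  mrule x y x' y' -> pulls_back (x :: y :: S) (x' :: y' :: S).
Proof.
case=> {x y x' y'} //=.
- move=> t1 b1 t2 b2 t1' b1' t2' b2' Et Eb; split=> // -[[t b]|] //=.
  by rewrite -!(mA mon) Et Eb.
- split=> // s /=.
  by rewrite !(mx1 mon).
- move=> a y; split=> // -[[t b]|] //=.
  by rewrite phiE (mx1 mon).
(* Read backwards, the guessed letter is absorbed into the pending factor [p]. *)
- move=> t b Ub; split=> // -[[t0 b0]|] //= [|]; last by right.
  case=> p [y [q [Up Uq E Et]]]; left; exists (ev b ** p), y, q.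
  by rewrite (mx1 mon) !(mA mon) -?(mA mon) in Et *; split=> //; apply: U_mul.
- move=> t b; split=> // -[[t0 b0]|] //= [|]; last by right.
  case=> y [q [Uq E Et]]; left; exists one, y, q.
  by rewrite (mx1 mon).
- move=> a; split=> // -[[t0 b0]|] //= [|]; last by right.
  case=> y [q [Uq E Et]]; left; exists (gen a ** y), q.
  by rewrite E /= (mA mon) -phiE -Et (mx1 mon).
- split=> // -[[t0 b0]|] //= [|]; last by right.
  by case=> q Uq ->; left; exists one, q; rewrite (mx1 mon).
- move=> t b Ub; split=> // -[[t0 b0]|] //= [|]; last by right.
  case=> q Uq Et; left; exists (ev b ** q); first exact: U_mul.
  by rewrite (mx1 mon) (mA mon).
- move=> t b; split=> // -[[t0 b0]|] //= [|]; last by right.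
  by move=> ->; left; exists one; rewrite // (mx1 mon).
- move=> t; split=> // -[[t0 b0]|] //= [|]; last by right.
  by move=> ->; left.
(* After a blank both values are [one], so [Compare] holds whatever follows. *)
- by split=> // s _ /=; left.
Qed.

Lemma pulls_back_rewrites n w w' : rewrites mrule n w w' -> pulls_back w w'.
Proof.
elim=> {n w w'} [n w|n w1 w2 w3 [P S x y x' y' R] _ [H1 H2]]; first by split.
have [H3 H4] : pulls_back (P ++ x :: y :: S) (P ++ x' :: y' :: S).
  by elim: P {H1 H2} => [|z P IH] /=; [apply: pulls_back_rule | apply: pulls_back_cons].
by split=> [s /H1/H3|z /H2/H4].
Qed.

Lemma good_Done s w : Done \in w -> good s w.
Proof.
elim: w s => //= x w IH s; rewrite inE => /predU1P[<- //|/IH H].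
by case: x => *; try exact: H; try by []; right; exact: H.
Qed.

Lemma good_blanks s m : ~ good s (nseq m Blank).
Proof. by elim: m s => [|m IH] s //=; apply: IH. Qed.

Lemma good_None_input w m : ~ good None (map inp w ++ nseq m Blank).
Proof.
elim: w => [|[a|] w IH] /=; last by case=> // /IH.
  exact: good_blanks.
exact: IH.
Qed.

Lemma raw_value_input w m y : raw_value (map inp w ++ nseq m Blank) = Some y ->
  exists2 v, w = map Some v & y = evA v.
Proof.
elim: w y => [|[a|] w IH] y //=.
  by case: m => [|m] [<-]; exists [::].
case E: (raw_value _) => [z|] //= [<-].
by have [v -> ->] := IH _ E; exists (a :: v).
Qed.

Local Notation U_rel := (U_rel mul U).

Lemma good_input t w m : good (Some (t, one)) (map inp w ++ nseq m Blank) ->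
  exists u v, w = encode_pair u v /\ U_rel (t ** evA u) (evA v).
Proof.
elim: w t => [|[a|] w IH] t /=.
- by move/good_blanks.
- move/IH => [u [v [-> H]]]; exists (a :: u), v; split=> //=.
  by rewrite (mA mon).
- case=> [|/good_None_input //].
  move=> [p [y [q [Up Uq /raw_value_input[v -> ->] ->]]]].
  by exists [::], v; split=> //; exists p, q; rewrite (mx1 mon) (m1x mon).
Qed.

Lemma machine_sound w m m' n x :
  rewrites mrule n (padded Blank m m' (map inp w)) x -> Done \in x ->
  exists u v, w = encode_pair u v /\ U_rel (evA u) (evA v).
Proof.
move=> /pulls_back_rewrites[H _] D; have := H (Some (one, one)) (good_Done _ D).
rewrite /padded => G.
have {G} : good (Some (one, one)) (map inp w ++ nseq m' Blank).
  by elim: m G {H} => [|m IH] //=.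
by move/good_input=> [u [v [-> H']]]; exists u, v; rewrite (m1x mon) in H'.
Qed.

End Soundness.

(** * Completeness, by an explicit run of polynomial length *)

Section Completeness.
Hypothesis K_gt0 : 0 < K.
Local Notation single := (single (B := B) K).

Definition cells (t b : seq letter) : seq sym := [seq Cell z.1 z.2 | z <- zip t b].

Lemma cells_cat t1 t2 b1 b2 : size t1 = size b1 ->
  cells (t1 ++ t2) (b1 ++ b2) = cells t1 b1 ++ cells t2 b2.
Proof. by move=> E; rewrite /cells zip_cat // map_cat. Qed.

Lemma split_window (T : Type) (P S b : seq T) (x y : T) :
  size b = size (P ++ x :: y :: S) ->
  exists b1 c1 c2 b2, b = b1 ++ c1 :: c2 :: b2 /\ size b1 = size P.
Proof.
rewrite size_cat /= => E; exists (take (size P) b).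
have : size (drop (size P) b) = (size S).+2 by rewrite size_drop E; lia.
case ED: (drop _ b) => [|c1 [|c2 b2]] //= _; exists c1, c2, b2.
by rewrite -ED cat_take_drop size_takel // E; lia.
Qed.

(** The other track stays put, since [same] is reflexive. *)
Lemma rewrites_top n t t' b : size b = size t -> rewrites same n t t' ->
  rewrites mrule n (cells t b) (cells t' b).
Proof.
move=> sz; rewrite -[n in rewrites mrule n]muln1.
apply: (steps_expand (I := fun v => size b = size v) (f := cells^~ b)) => //.
move=> v v' sv S; split; first by rewrite (rstep_size S).
case: S sv => P S x y x' y' R sv.
have [b1 [c1 [c2 [b2 [-> sb]]]]] := split_window sv.
by rewrite !cells_cat //=; apply: rewrites_rule; apply: mr_cell.
Qed.

Lemma rewrites_bottom n t b b' : size t = size b -> rewrites same n b b' ->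
  rewrites mrule n (cells t b) (cells t b').
Proof.
move=> sz; rewrite -[n in rewrites mrule n]muln1.
apply: (steps_expand (I := fun v => size t = size v) (f := cells t)) => //.
move=> v v' sv S; split; first by rewrite (rstep_size S).
case: S sv => P S x y x' y' R sv.
have [b1 [c1 [c2 [b2 [-> sb]]]]] := split_window sv.
by rewrite !cells_cat //=; apply: rewrites_rule; apply: mr_cell.
Qed.

Lemma size_pad T (x : seq letter) : size x <= T -> size (pad T x) = T.
Proof. by move=> xT; rewrite size_cat size_nseq subnK. Qed.

Section Insert.
Variable mark : sym.
Hypothesis insert_rule : forall t (b : letter), U (ev b) -> mrule (Cell t eps) mark (Cell t b) mark.

(** A padding letter is moved through [x] to the cell beside the marker, where the guess overwrites
    it. *)
Lemma insert1 T t x b : size t = T -> size x < T -> U (genB b) ->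
  rewrites mrule (T + 1) (cells t (pad T x) ++ [:: mark])
    (cells t (pad T (rcons x (single b))) ++ [:: mark]).
Proof.
move=> st sx Ub; pose j := T - (size x).+1.
have Ej : T - size x = j.+1 by rewrite /j; lia.
apply: (@steps_trans _ _ _ _ _ (cells t (nseq j eps ++ rcons x eps) ++ [:: mark])).
  apply: rewrites_ctxr; apply: rewrites_bottom; first by rewrite size_pad // ltnW.
  apply: (@steps_le _ _ (size x)); first exact: ltnW.
  rewrite /pad Ej -addn1 nseqD -catA; apply: rewrites_ctxl.
  exact: shift_right.
rewrite /pad size_rcons -/j -!cats1 !catA.
have : size t = size (nseq j eps ++ x) + 1.
  by rewrite size_cat size_nseq st /j; lia.
case/lastP: t {st} => [|t c]; first by rewrite addn1.
rewrite size_rcons addn1 => -[st]; rewrite -cats1 !cells_cat // -!catA /=.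
apply: rewrites_rule; apply: insert_rule.
by rewrite packE //= (mx1 mon).
Qed.

Lemma insert T t x s : size t = T -> size x + size s <= T -> U (ev s) ->
  rewrites mrule (size s * (T + 1)) (cells t (pad T x) ++ [:: mark])
    (cells t (pad T (x ++ map single s)) ++ [:: mark]).
Proof.
move=> st; elim: s x => [|b s IH] x /= sx Us; first by rewrite cats0; apply: steps_refl.
have [Ub {}Us] := U_fac Us.
rewrite mulSn; apply: (steps_trans (insert1 st _ Ub)); first by lia.
by rewrite -(cat_rcons (single b) x); apply: IH => //; rewrite size_rcons; lia.
Qed.

End Insert.

Lemma fill_blanks m : rewrites mrule m (nseq m.+1 Blank)
  (Blank :: cells (nseq m eps) (nseq m eps)).
Proof.
elim: m => [|m IH]; first exact: steps_refl.
apply: (@steps_le _ _ (m + 1)); first by rewrite addn1.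
apply: steps_trans (rewrites_ctxl [:: Blank] IH) _.
by apply: (@rewrites_rule _ _ [::]); apply: mr_blank.
Qed.

Lemma raw_cells u y S : rewrites mrule (size u) (map Raw u ++ y :: S)
  (cells (map phi u) (nseq (size u) eps) ++ y :: S).
Proof.
elim: u => [|a u]; first exact: steps_refl.
rewrite [cells (map phi (a :: u)) _ ++ _](_ : _ = Cell (phi a) eps ::
  (cells (map phi u) (nseq (size u) eps) ++ y :: S)) //.
have : cells (map phi u) (nseq (size u) eps) ++ y :: S != [::] by case: (cells _ _).
case: (cells _ _ ++ y :: S) => // z w _ IH.
apply: (@steps_le _ _ (size u + 1)); first by rewrite addn1.
apply: steps_trans (rewrites_ctxl [:: Raw a] IH) _.
by apply: (@rewrites_rule _ _ [::] w); apply: mr_raw.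
Qed.

Lemma load_cells v S : rewrites mrule (size v) (Middle :: map Raw v ++ S)
  (cells (nseq (size v) eps) (map phi v) ++ Middle :: S).
Proof.
elim: v => [|a v IH]; first exact: steps_refl.
apply: (@steps_cons _ _ _ _ (Cell eps (phi a) :: Middle :: map Raw v ++ S)).
  by apply: (@RStep _ _ [::]); apply: mr_middle.
exact: (rewrites_ctxl [:: Cell eps (phi a)] IH).
Qed.

Lemma compare_cells t : rewrites mrule (size t) (cells t t ++ [:: Compare])
  (Compare :: cells (nseq (size t) eps) (nseq (size t) eps)).
Proof.
elim/last_ind: t => [|t c IH]; first exact: steps_refl.
rewrite size_rcons -addn1 addnC -cats1 cells_cat // -catA.
apply: (@steps_trans _ _ _ _ _ (cells t t ++ [:: Compare; Cell eps eps])).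
  by apply: rewrites_rule; apply: mr_compare.
have -> : cells (nseq (1 + size t) eps) (nseq (1 + size t) eps) =
    cells (nseq (size t) eps) (nseq (size t) eps) ++ [:: Cell eps eps].
  by rewrite addnC nseqD cells_cat.
by have := rewrites_ctxr [:: Cell eps eps] IH; rewrite -catA.
Qed.

Lemma last_cell_mark T t b x y : size t = T -> size b = T -> 0 < T ->
  (forall t b, mrule (Cell t b) x (Cell t b) y) ->
  rewrites mrule 1 (cells t b ++ [:: x]) (cells t b ++ [:: y]).
Proof.
move=> st sb T_gt0 H.
case/lastP: t st => [|t c] st; first by rewrite -st in T_gt0.
case/lastP: b sb => [|b c'] sb; first by rewrite -sb in T_gt0.
have E : size t = size b by move: st; rewrite -sb !size_rcons => -[].
by rewrite -!cats1 !cells_cat // -!catA; apply: rewrites_rule.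
Qed.

Local Notation gword := (gword mul one genB).
Local Notation near := (near mul one genB).

Hypothesis lc : left_cancellative mul.
Hypothesis GenB : generates mul one genB.
Variables k CA C D : nat.
Hypothesis HA : forall p c r, gword p -> gword r -> size c <= k ->
  ev r = ev p ** ev c -> size p <= size r + CA.
Hypothesis HL : forall p c r, gword p -> gword r -> size c <= k ->
  ev r = ev p ** ev c ->
  forall j, j <= size r -> near D (ev (take (j - C) p)) (ev (take j r)).
Hypothesis HK : CA + C + k + D < K.
Hypothesis k_gt0 : 0 < k.
Hypothesis phi_k : forall a, size (phi a) <= k.

(** The first three terms are the room required by [normalise_pad]; the last [N] is for the input
    letters. *)
Definition tape_size N := k * N + N + 3 + N.

Definition run_time N := let T := tape_size N in
  10 * (T + 1) * (T + 1) + 2 * (cost k CA C N * (4 * T + 1)).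

Lemma evs_phi u : evs (map phi u) = evA u.
Proof. by elim: u => //= a u ->; rewrite phiE. Qed.

Lemma cost_mono m n : m <= n -> cost k CA C m <= cost k CA C n.
Proof. by move=> mn; apply: leq_mul => //; rewrite leq_add2r leq_add2l leq_mul2l mn orbT. Qed.

(** The run creates the cells, guesses [p], loads [v], guesses [q], rewrites both tracks to the
    common geodesic [g], and lets [Compare] move left over equal cells up to the remaining blank. *)
Lemma machine_complete N u v p q :
  U (ev p) -> U (ev q) -> evA u = ev p ** evA v ** ev q ->
  size u + size v + size p + size q <= N ->
  exists x, Done \in x /\ rewrites mrule (run_time N)
    (padded Blank (k * N + N + 3).+1 1 (map inp (encode_pair u v))) x.
Proof.
move=> Up Uq E sN; set m := k * N + N + 3.
(* [T0] and [T1] count the cells before and after [v] is loaded. *)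
pose T0 := m + size u; pose T1 := T0 + size v; pose T := tape_size N.
have le_T1 : T1 <= T by rewrite /T1 /T0 /T /tape_size -/m; lia.
have [g gg Eg] := gword_exists GenB (evA u).
pose xt := map phi u ++ nseq (size v) eps.
pose xb := (map single p ++ map phi v) ++ map single q.
have sxt : size xt <= N by rewrite size_cat size_map size_nseq; lia.
have sxb : size xb <= N by rewrite !size_cat !size_map; lia.
have padt : nseq m eps ++ xt = pad T1 xt.
  rewrite /pad; congr (nseq _ _ ++ _).
  by rewrite /T1 /T0 size_cat size_map size_nseq; lia.
have kt (c : letter) : c \in xt -> size c <= k.
  by rewrite mem_cat => /orP[/mapP[a _ ->]//|/nseqP[-> _]].
have kb (c : letter) : c \in xb -> size c <= k.
  have ks s : c \in map single s -> size c <= k.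
    by move=> /mapP[b _ ->]; rewrite packE.
  by rewrite !mem_cat -orbA => /or3P[/ks//|/mapP[a _ ->]//|/ks].
have Et : ev g = evs xt by rewrite (eval_cat mon) evs_phi -(cats0 (nseq _ _)) evs_eps // (mx1 mon).
have Eb : ev g = evs xb by rewrite !(eval_cat mon) !evs_single // evs_phi Eg.
have roomy n : n <= N -> k * n + n + 3 <= T1.
  move=> nN; have : k * n <= k * N by rewrite leq_mul2l nN orbT.
  by rewrite /T1 /T0 /m; lia.
have Nt := normalise_pad mon lc GenB HA HL HK kt gg Et (roomy _ sxt).
have Nb := normalise_pad mon lc GenB HA HL HK kb gg Eb (roomy _ sxb).
pose top0 := nseq m eps ++ map phi u.
have st0 : size top0 = T0 by rewrite size_cat size_nseq size_map.
have sp0 : size p <= T0 by rewrite /T0 /m; lia.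
pose tail : seq sym := map Raw v ++ [:: Blank].
have s1 : rewrites mrule (m + size u) (nseq m.+1 Blank ++ map Raw u ++ Front :: tail)
    (Blank :: cells top0 (pad T0 [::]) ++ Front :: tail).
  apply: steps_trans (rewrites_ctxr _ (fill_blanks m)) _.
  have -> : cells top0 (pad T0 [::]) = cells (nseq m eps) (nseq m eps) ++
      cells (map phi u) (nseq (size u) eps).
    by rewrite -cells_cat // -nseqD /pad subn0 cats0.
  rewrite -catA.
  exact: (rewrites_ctxl (Blank :: cells (nseq m eps) (nseq m eps)) (raw_cells u Front tail)).
have s2 : rewrites mrule (size p * (T0 + 1)) (cells top0 (pad T0 [::]) ++ [:: Front])
    (cells top0 (pad T0 (map single p)) ++ [:: Front]).
  exact: (insert mr_front st0).
have szp : size (pad T0 (map single p)) = T0 by rewrite size_pad ?size_map.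
have s3 : rewrites mrule 1 (cells top0 (pad T0 (map single p)) ++ [:: Front])
    (cells top0 (pad T0 (map single p)) ++ [:: Middle]).
  by apply: (@last_cell_mark T0) => //; [rewrite /T0 /m; lia | exact: mr_front_middle].
have s4 := load_cells v [:: Blank].
pose top1 := nseq m eps ++ xt.
have st1 : size top1 = T1 by rewrite /top1 padt size_pad // /T1 /T0 /m; lia.
have E4 : cells top0 (pad T0 (map single p)) ++ cells (nseq (size v) eps) (map phi v)
    = cells top1 (pad T1 (map single p ++ map phi v)).
  rewrite -cells_cat ?szp // /top1 /xt catA; congr (cells _ _).
  rewrite /pad catA size_cat !size_map; congr ((nseq _ _ ++ _) ++ _).
  by rewrite /T1; lia.
have s5 : rewrites mrule 1 ([:: Middle; Blank]) [:: Back; Blank].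
  by apply: (@rewrites_rule _ _ [::]); apply: mr_middle_back.
have s6 : rewrites mrule (size q * (T1 + 1))
    (cells top1 (pad T1 (map single p ++ map phi v)) ++ [:: Back])
    (cells top1 (pad T1 xb) ++ [:: Back]).
  apply: (insert mr_back st1) => //; rewrite size_cat !size_map /T1 /T0 /m; lia.
have szb : size (pad T1 xb) = T1 by rewrite size_pad // /T1 /T0 /m; lia.
have s7 : rewrites mrule 1 (cells top1 (pad T1 xb) ++ [:: Back])
    (cells top1 (pad T1 xb) ++ [:: Compare]).
  by apply: (@last_cell_mark T1) => //; [rewrite /T1 /T0 /m; lia | exact: mr_back_compare].
pose z := pad T1 (map single g).
have szz : size z = T1 by rewrite /z (rewrites_size Nb).
have s8 := rewrites_ctxr [:: Compare] (rewrites_bottom (etrans st1 (esym szb)) Nb).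
have s9 : rewrites mrule (cost k CA C (size xt) * (4 * T1 + 1)) (cells top1 z ++ [:: Compare])
    (cells z z ++ [:: Compare]).
  apply: rewrites_ctxr; rewrite /top1 padt in st1 *.
  by apply: rewrites_top Nt; rewrite szz st1.
have s10 := rewrites_ctxl [:: Blank] (compare_cells z).
pose rest := cells (nseq (size z) eps) (nseq (size z) eps).
have s11 : rewrites mrule 1 ([:: Blank; Compare] ++ rest) ([:: Blank; Done] ++ rest).
  by apply: (@rewrites_rule _ _ [::]); apply: mr_done.
exists (([:: Blank; Done] ++ rest) ++ [:: Blank]); split; first by rewrite !inE eqxx orbT.
have -> : padded Blank m.+1 1 (map inp (encode_pair u v)) =
    nseq m.+1 Blank ++ map Raw u ++ Front :: tail.
  by rewrite /padded /encode_pair map_cat -catA /= -!map_comp.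
have catM (X : seq sym) x Y : Blank :: X ++ x :: Y = [:: Blank] ++ (X ++ [:: x]) ++ Y.
  by rewrite -catA.
have {}s2 := rewrites_ctx [:: Blank] tail (steps_trans s2 s3).
rewrite -!catM in s2.
have {}s4 := rewrites_ctxl (Blank :: cells top0 (pad T0 (map single p))) s4.
have {}s5 := rewrites_ctxl (Blank :: cells top1 (pad T1 (map single p ++ map phi v))) s5.
rewrite /= [_ ++ (_ ++ _)]catA E4 in s4.
rewrite /= [X in rewrites _ _ _ X]catM in s5.
have {}s6 := rewrites_ctx [:: Blank] [:: Blank]
  (steps_trans s6 (steps_trans s7 (steps_trans s8 s9))).
have {}s10 := rewrites_ctxr [:: Blank] (steps_trans s10 s11).
have := steps_trans s1 (steps_trans s2 (steps_trans s4 (steps_trans s5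
  (steps_trans s6 s10)))).
apply: steps_le; rewrite /run_time -/T szz.
have c1 : cost k CA C (size xt) * (4 * T1 + 1) <= cost k CA C N * (4 * T + 1).
  by apply: leq_mul; [apply: cost_mono | lia].
have c2 : cost k CA C (size xb) * (4 * T1 + 1) <= cost k CA C N * (4 * T + 1).
  by apply: leq_mul; [apply: cost_mono | lia].
have leT0 : T0 <= T1 by rewrite /T1 leq_addr.
have leN : N <= T by rewrite /T /tape_size; lia.
have c3 : size p * (T0 + 1) <= T * (T + 1) by apply: leq_mul; lia.
have c4 : size q * (T1 + 1) <= T * (T + 1) by apply: leq_mul; lia.
have c5 : T + 1 <= (T + 1) * (T + 1) by rewrite leq_pmulr // addn1.
have c6 : T * (T + 1) <= (T + 1) * (T + 1) by rewrite leq_mul2r leq_addr orbT.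
have c7 : m + size u <= T1 by rewrite /T1 leq_addr.
move: c1 c2 c3 c4 c5 c6 c7; rewrite -[10 * _ * _]mulnA.
move: (cost _ _ _ (size xt) * _) (cost _ _ _ (size xb) * _) (cost _ _ _ N * _).
move: (size p * _) (size q * _) ((T + 1) * (T + 1)) (T * (T + 1)).
by lia.
Qed.

End Completeness.
End Machine.

(** * Green's relations *)

Lemma in_NP_ext (S : finType) (L L' : seq S -> Prop) :
  (forall w, L w <-> L' w) -> in_NP L -> in_NP L'.
Proof.
move=> E [Q [G [blank [inp [q0 [qacc [delta [c [e H]]]]]]]]].
exists Q, G, blank, inp, q0, qacc, delta, c, e => w.
by rewrite -E.
Qed.

Lemma U_rel_in_NP (M : eqType) (mul : M -> M -> M) (one : M)
    (A : finType) (gen : A -> M) (U : M -> Prop) :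
  is_monoid mul one -> generates mul one gen -> left_cancellative mul ->
  bounded_indegree mul gen -> strongly_hyperbolic_monoid mul one ->
  U one -> (forall x y, U x -> U y -> U (mul x y)) ->
  (forall x y, U (mul x y) -> U x /\ U y) ->
  relation_in_NP mul one gen (U_rel mul U).
Proof.
move=> mon Gen lc bid [B [genB [GenB [d hyp]]]] U1 UM UF.
have fib := fibre_le_all mon Gen bid.
have /choice[wa Ewa] : forall a, exists w, gen a = eval_word mul one genB w.
  by move=> a; apply: GenB.
(* The successor makes [k] positive, so that guessed single generators also have length at most
   [k]. *)
pose k := (\max_a size (wa a)).+1.
have [CA HA] := right_mul_length mon lc GenB fib hyp k.
have [C [D HL]] := lagging_geodesics mon lc GenB fib hyp k.
have [F HF] := factor_length mon lc GenB fib hyp UM UF.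
pose K := (CA + C + k + D).+1; have HK : CA + C + k + D < K by [].
pose phi a : K.-bseq B := pack K (wa a).
have wak a : size (wa a) <= k by rewrite /k ltnW // ltnS (leq_bigmax a).
have phiV a : phi a = wa a :> seq B.
  by rewrite packE // (leq_trans (wak a)) // /K; lia.
have phiE a : eval_word mul one genB (phi a) = gen a by rewrite phiV Ewa.
have phi_k a : size (phi a) <= k by rewrite phiV.
(* Geodesics for [u] and [v] have total length at most [k * n], so [factor_length] bounds each of
   [p] and [q] by [F * (k * n + 1)]. *)
pose N n := n + 2 * (F * (k * n + 1)).
pose f n := run_time k CA C (N n) + (k * N n + N n + 3 + 1).
apply: (@rewriting_in_NP _ _ Blank (@inp A B K) Done
  (mrule mul one genB phi U) _ f).
- rewrite /f /run_time /tape_size /cost /N.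
  by repeat first [exact: poly_bounded_id | exact: poly_bounded_const
                  | apply: poly_boundedD | apply: poly_boundedM].
- by move=> [[|? u] [v []]].
- move=> w [u [v [-> Huv]]].
  have [r gr Er] := gword_exists GenB (eval_word mul one gen u).
  have [b gb Eb] := gword_exists GenB (eval_word mul one gen v).
  have len s g : gword mul one genB g ->
      eval_word mul one genB g = eval_word mul one gen s -> size g <= k * size s.
    move=> gg Eg; rewrite -(size_map phi s); apply: gword_size_le gg _ => //.
      by move=> c /mapP[a _ ->].
    by rewrite Eg (evs_phi phiE).
  have := HF r b gr gb; rewrite Er Eb => /(_ Huv)[p [q [Up Uq E sp sq]]].
  set n := size (encode_pair u v).
  have sn : size u + size v < n.
    by rewrite /n /encode_pair size_cat /= !size_map; lia.
  have le_rb : size r + size b + 1 <= k * n + 1.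
    rewrite leq_add2r; apply: leq_trans (leq_add (len _ _ gr Er) (len _ _ gb Eb)) _.
    by rewrite -mulnDr leq_mul2l ltnW // orbT.
  have sN : size u + size v + size p + size q <= N n.
    have := leq_mul (leqnn F) le_rb; rewrite /N; lia.
  have [x [Dx Rx]] := machine_complete mon phiE UF (ltn0Sn _) lc GenB HA HL HK
    (ltn0Sn _) phi_k Up Uq E sN.
  exists (k * N n + N n + 3).+1, x; split=> //.
    by rewrite /f addn1 leq_addl.
  by apply: steps_le Rx; rewrite /f leq_addr.
- move=> w m m' n x; exact: machine_sound.
Qed.

Definition is_unit (M : Type) (mul : M -> M -> M) (one x : M) :=
  exists2 y, mul x y = one & mul y x = one.

Section DRelation.
Variables (M : eqType) (mul : M -> M -> M) (one : M).
Hypothesis mon : is_monoid mul one.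
Hypothesis can : cancellative mul.
Local Notation "x ** y" := (mul x y) (at level 40, left associativity).

Lemma is_unit_mul x y : is_unit mul one x -> is_unit mul one y -> is_unit mul one (x ** y).
Proof.
move=> [x' E1 E2] [y' F1 F2]; exists (y' ** x').
  by rewrite (mA mon) -(mA mon x) F1 (mx1 mon).
by rewrite (mA mon) -(mA mon y') E2 (mx1 mon).
Qed.

Lemma is_unit_right_inv x y : x ** y = one -> is_unit mul one x /\ is_unit mul one y.
Proof.
move=> E; have F : y ** x = one.
  by apply: (can.1 x); rewrite (mA mon) E (m1x mon) (mx1 mon).
by split; [exists y | exists x].
Qed.

Lemma is_unit_fac x y : is_unit mul one (x ** y) -> is_unit mul one x /\ is_unit mul one y.
Proof.
move=> [z E1 E2]; split.
  by have [] := @is_unit_right_inv x (y ** z); rewrite ?(mA mon).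
by have [] := @is_unit_right_inv (z ** x) y; rewrite -?(mA mon).
Qed.

(** Two elements related by [L_rel] are left multiples of each other, and right cancellation makes
    the multipliers mutually inverse; dually for [R_rel]. Conversely [y ** q] is the intermediate
    element. *)
Lemma D_rel_units x y : D_rel mul x y <-> U_rel mul (is_unit mul one) x y.
Proof.
split=> [[c [L R]]|[p [q [[p' E1 E2] [q' F1 F2] ->]]]].
  have [a Ea] : exists a, x = a ** c by apply: (L x).1; exists one; rewrite (m1x mon).
  have [b Eb] : exists b, c = b ** x by apply: (L c).2; exists one; rewrite (m1x mon).
  have [e Ee] : exists e, c = y ** e by apply: (R c).1; exists one; rewrite (mx1 mon).
  have [h Eh] : exists h, y = c ** h by apply: (R y).2; exists one; rewrite (mx1 mon).
  exists a, e; split.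
  - have [|Ua _ //] := @is_unit_right_inv a b.
    by apply: (can.2 x); rewrite -(mA mon) -Eb -Ea (m1x mon).
  - have [|Ue _ //] := @is_unit_right_inv e h.
    by apply: (can.1 y); rewrite (mA mon) -Ee -Eh (mx1 mon).
  - by rewrite -(mA mon) -Ee.
exists (y ** q); split=> z; split=> [[s ->]|[s ->]].
- by exists (s ** p); rewrite !(mA mon).
- by exists (s ** p'); rewrite !(mA mon) -(mA mon s p') E2 (mx1 mon).
- by exists (q ** s); rewrite !(mA mon).
- by exists (q' ** s); rewrite !(mA mon) -(mA mon y q) F1 (mx1 mon).
Qed.

End DRelation.

Lemma J_le_factor (M : eqType) (mul : M -> M -> M) (one : M) x y : is_monoid mul one ->
  J_le mul x y <-> U_rel mul (fun=> True) x y.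
Proof.
move=> [mA m1x mx1]; split=> [J|[p [q [_ _ ->]]] z [s [t ->]]].
  have [|p [q E]] := J x; first by exists one, one; rewrite m1x mx1.
  by exists p, q.
by exists (mul s p), (mul q t); rewrite !mA.
Qed.

Theorem theorem6p6 (M : Type) (mul : M -> M -> M) (one : M)
  (A : finType) (gen : A -> M) :
  is_monoid mul one ->
  generates mul one gen ->
  left_cancellative mul ->
  bounded_indegree mul gen ->
  strongly_hyperbolic_monoid mul one ->
  relation_in_NP mul one gen (J_le mul) /\
  (cancellative mul -> relation_in_NP mul one gen (D_rel mul)).
Proof.
(* Classical equality on [M] gives access to [uniq] and membership in sequences. *)
pose M' : eqType := HB.pack M (gen_eqMixin M).
move=> mon Gen lc bid hyp.
have ext (R R' : M -> M -> Prop) : (forall x y, R x y <-> R' x y) ->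
    relation_in_NP mul one gen R' -> relation_in_NP mul one gen R.
  move=> E; apply: in_NP_ext => w.
  by split=> -[u [v [-> H]]]; exists u, v; split=> //; apply/E.
split.
  apply: ext (@U_rel_in_NP M' mul one A gen (fun=> True) mon Gen lc bid hyp _ _ _) => //.
  by move=> x y; apply: (@J_le_factor M' mul one x y mon).
move=> can.
have UN := @U_rel_in_NP M' mul one A gen (is_unit mul one) mon Gen lc bid hyp.
apply: ext (UN _ _ _).
- exact: (@D_rel_units M' mul one mon can).
- by exists one; case: mon.
- exact: (@is_unit_mul M' mul one mon).
- exact: (@is_unit_fac M' mul one mon can).
Qed.
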